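(* Let $X$ and $Y$ be metric spaces with bounded geometry. The following are equivalent: (1) $X$ and $Y$ are coarsely equivalent. (2) For every $p\in[1,\infty)$, there is an isometric isomorphism $\phi:B^p_u(X)\otimes\overline{M}^p_\infty\to B^p_u(Y)\otimes\overline{M}^p_\infty$ such that $\phi(\ell^\infty(X)\otimes C_0(\mathbb{N}))=\ell^\infty(Y)\otimes C_0(\mathbb{N})$. (3) $B^p_u(X)\otimes\overline{M}^p_\infty$ and $B^p_u(Y)\otimes\overline{M}^p_\infty$ are isometrically isomorphic for every $p\in[1,\infty)$. (4) $B^p_u(X)\otimes\overline{M}^p_\infty$ and $B^p_u(Y)\otimes\overline{M}^p_\infty$ are isometrically isomorphic for some $p\in[1,\infty)\setminus\{2\}$. (5) For some $p\in[1,\infty)$, there is an isometric isomorphism $\phi:B^p_u(X)\otimes\overline{M}^p_\infty\to B^p_u(Y)\otimes\overline{M}^p_\infty$ such that $\phi(\ell^\infty(X)\otimes C_0(\mathbb{N}))=\ell^\infty(Y)\otimes C_0(\mathbb{N})$.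
   Context: A metric space $X$ has bounded geometry if for all $R\ge 0$ there is $N_R\in\mathbb{N}$ such that every ball of radius $R$ in $X$ has at most $N_R$ elements. A map $f:X\to Y$ is uniformly expansive if for all $R>0$ there is $S>0$ such that $d(x_1,x_2)\le R$ implies $d(f(x_1),f(x_2))\le S$. Two maps $f,g:X\to Y$ are close if there is $C>0$ with $d(f(x),g(x))\le C$ for all $x\in X$. $X$ and $Y$ are coarsely equivalent if there are uniformly expansive maps $f:X\to Y$, $g:Y\to X$ such that $f\circ g$ and $g\circ f$ are close to the identity maps. For $T\in B(\ell^p(X))$ put $T_{xy}=(T\delta_y)(x)$; the propagation of $T$ is $\sup\{d(x,y):T_{xy}\ne 0\}$. The $\ell^p$ uniform Roe algebra $B^p_u(X)$ is the operator norm closure in $B(\ell^p(X))$ of the algebra of all bounded operators on $\ell^p(X)$ with finite propagation. $\overline{M}^p_\infty=\overline{\bigcup_{n}M_n(\mathbb{C})}\subset B(\ell^p(\mathbb{N}))$ (norm closure, $M_n(\mathbb{C})$ acting on the first $n$ coordinates). For norm-closed subalgebras $A\subseteq B(\ell^p(I))$, $B\subseteq B(\ell^p(J))$ with $I,J$ countable, $A\otimes B\subseteq B(\ell^p(I\times J))$ is the closed linear span of the operators $a\otimes b$ ($a\in A$, $b\in B$), where $(a\otimes b)(\xi\otimes\eta)=a\xi\otimes b\eta$ and $(\xi\otimes\eta)(i,j)=\xi(i)\eta(j)$. $\ell^\infty(X)$ acts on $\ell^p(X)$ and $C_0(\mathbb{N})$ acts on $\ell^p(\mathbb{N})$ by multiplication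 operators. Isometric isomorphism means an isometric (complex-linear, multiplicative, bijective) algebra isomorphism. *)

(* Defs.v *)
From HB Require Import structures.
From mathcomp Require Import all_boot all_order all_algebra.
From mathcomp Require Import all_classical all_reals all_analysis.
From mathcomp Require Import complex.

Set Implicit Arguments.
Unset Strict Implicit.
Unset Printing Implicit Defensive.

Import Order.TTheory GRing.Theory Num.Theory.
Import numFieldNormedType.Exports.

Local Open Scope classical_set_scope.
Local Open Scope ring_scope.
Local Open Scope complex_scope.

Export Normc.

Section coarse_geometry.
Context {R : realType}.

Definition bounded_geometry (X : metricType R) :=
  forall r : R, 0 <= r -> exists N : nat,
    forall x : X, ([set y | mdist x y <= r] #<= `I_N)%card.

Definition uniformly_expansive (X Y : metricType R) (f : X -> Y) :=
  forall r : R, 0 < r -> exists2 s : R, 0 < s &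
    forall x1 x2 : X, mdist x1 x2 <= r -> mdist (f x1) (f x2) <= s.

Definition close_maps (S : Type) (Y : metricType R) (f g : S -> Y) :=
  exists2 c : R, 0 < c & forall x, mdist (f x) (g x) <= c.

Definition coarsely_equivalent (X Y : metricType R) :=
  exists (f : X -> Y) (g : Y -> X),
    [/\ uniformly_expansive f, uniformly_expansive g,
        close_maps (f \o g) id & close_maps (g \o f) id].

End coarse_geometry.

Section lp_space.
Context {R : realType} (I : choiceType).

Definition lp_sum (p : R) (f : I -> R[i]) : \bar R :=
  \esum_(i in [set: I]) (normc (f i) `^ p)%:E.

Definition lp_pred (p : R) (p1 : 1 <= p) : {pred I -> R[i]} :=
  fun f => `[< (lp_sum p f < +oo)%E >].

Lemma esum_scale_lty (c : R) (a : I -> R) : 0 <= c -> (forall i, 0 <= a i) ->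
  (\esum_(i in [set: I]) (a i)%:E < +oo)%E ->
  (\esum_(i in [set: I]) (c * a i)%:E < +oo)%E.
Proof.
move=> c0 a0 afin; set s := (\esum_(i in _) _)%E in afin.
have s0 : (0 <= s)%E by apply: esum_ge0 => i _; rewrite lee_fin.
apply: (@le_lt_trans _ _ (c%:E * s)%E); last first.
  by rewrite -(@fineK _ s) ?ge0_fin_numE// -EFinM ltry.
apply: ge_ereal_sup => _ [F FI <-].
under eq_fsbigr do rewrite EFinM.
rewrite -ge0_mule_fsumr; last by move=> i; rewrite lee_fin.
by apply: lee_wpmul2l; [rewrite lee_fin|apply: ereal_sup_ubound; exists F].
Qed.

Lemma lp_submod_closed (p : R) (p1 : 1 <= p) : submod_closed (lp_pred p1).
Proof.
have p0 : 0 <= p by rewrite (le_trans _ p1).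
have pn0 : p != 0 by rewrite gt_eqF// (lt_le_trans _ p1).
have normc_ge0 (z : R[i]) : 0 <= normc z by case: z => a b; exact: sqrtr_ge0.
split.
  apply/asboolP; rewrite /lp_sum esum1// => i _.
  by rewrite [normc _]normc0 powR0.
move=> c f g /asboolP ff /asboolP gf; apply/asboolP.
have cff : (lp_sum p (c *: f) < +oo)%E.
  rewrite /lp_sum; under eq_esum => i _ do rewrite /= normcM powRM//.
  by apply: esum_scale_lty => //; [exact: powR_ge0|move=> i; exact: powR_ge0].
apply: (@le_lt_trans _ _ (\esum_(i in [set: I])
    (2 `^ p * (normc ((c *: f) i) `^ p + normc (g i) `^ p))%:E)%E).
  apply: le_esum => i _; rewrite lee_fin.
  set u := (c *: f) i; set v := g i.
  have uv : normc (u + v) <= 2 * Num.max (normc u) (normc v).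
    rewrite (le_trans (le_normcD _ _))// mulr2n mulrDl mul1r.
    by rewrite lerD// le_max lexx// orbT.
  apply: (@le_trans _ _ ((2 * Num.max (normc u) (normc v)) `^ p)).
    by apply: ge0_ler_powR; rewrite ?nnegrE// mulr_ge0// le_max normc_ge0.
  rewrite powRM// ?le_max ?normc_ge0// ler_wpM2l ?powR_ge0//.
  by case: (leP (normc u)) => _; rewrite ?lerDl ?lerDr powR_ge0.
apply: esum_scale_lty => [|i|]; [exact: powR_ge0|by rewrite addr_ge0 ?powR_ge0|].
under eq_esum => i _ do rewrite EFinD.
rewrite esumD => [|i _|i _]; rewrite ?lee_fin ?powR_ge0//.
exact: lte_add_pinfty.
Qed.

Record lp (p : R) (p1 : 1 <= p) := Lp {
  lp_val :> I -> R[i] ;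
  _ : lp_val \in lp_pred p1 }.

Section instances.
Variables (p : R) (p1 : 1 <= p).

HB.instance Definition _ :=
  GRing.isSubmodClosed.Build _ _ (lp_pred p1) (lp_submod_closed p1).
HB.instance Definition _ := [isSub for @lp_val p p1].
HB.instance Definition _ := [Choice of lp p1 by <:].
HB.instance Definition _ := [SubChoice_isSubLmodule of lp p1 by <:].

Definition lp_norm (f : lp p1) : R := fine (lp_sum p f) `^ p^-1.

Definition delta_fun (j : I) : I -> R[i] := fun i => (i == j)%:R.

Lemma lp_delta (j : I) : delta_fun j \in lp_pred p1.
Proof.
have pn0 : p != 0 by rewrite gt_eqF// (lt_le_trans _ p1).
apply/asboolP; rewrite /lp_sum.
rewrite (esumID [set j]) => [|i _]; last by rewrite lee_fin powR_ge0.
rewrite setTI esum_set1 ?lee_fin ?powR_ge0//.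
rewrite [X in (_ + X)%E]esum1 ?adde0 ?ltry// => i [_ /= /eqP ij].
by rewrite /delta_fun (negbTE ij) normc0 powR0.
Qed.

Definition delta (j : I) : lp p1 := Lp (lp_delta j).

End instances.
End lp_space.

Section tensor_vectors.
Context {R : realType} (I J : choiceType) (p : R) (p1 : 1 <= p).

Lemma lp_tensor (xi : lp I p1) (eta : lp J p1) :
  (fun k : I * J => xi k.1 * eta k.2) \in lp_pred p1.
Proof.
have normc_ge0 (z : R[i]) : 0 <= normc z by case: z => a b; exact: sqrtr_ge0.
case: xi eta => [f /asboolP ff] [g /asboolP gf] /=; apply/asboolP.
have g0 : (0 <= lp_sum p g)%E by apply: esum_ge0 => j _; rewrite lee_fin powR_ge0.
rewrite /lp_sum; under eq_esum => k _ do rewrite normcM powRM//.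
have -> : [set: I * J] = setT `*`` (fun=> setT) by apply/seteqP; split.
rewrite -(@esum_esum _ _ _ _ _
  (fun i j => (normc (f i) `^ p * normc (g j) `^ p)%:E)); last first.
  by move=> *; rewrite lee_fin mulr_ge0 ?powR_ge0.
apply: (@le_lt_trans _ _ (\esum_(i in [set: I])
    (fine (lp_sum p g) * normc (f i) `^ p)%:E)%E).
  apply: le_esum => i _; rewrite mulrC EFinM fineK ?ge0_fin_numE//.
  apply: ge_ereal_sup => _ [F FI <-].
  under eq_fsbigr do rewrite EFinM.
  rewrite -ge0_mule_fsumr; last by move=> j; rewrite lee_fin powR_ge0.
  apply: lee_wpmul2l; first by rewrite lee_fin powR_ge0.
  by apply: ereal_sup_ubound; exists F.
by apply: esum_scale_lty => [|i|//]; [exact: fine_ge0|exact: powR_ge0].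
Qed.

Definition tensor_vec (xi : lp I p1) (eta : lp J p1) : lp (I * J)%type p1 :=
  Lp (lp_tensor xi eta).

End tensor_vectors.

(* Operators are plain functions on [lp I p1], so that sums and scalings are
   the pointwise ones and the product is [\o]; B(l^p(I)) is a set of them. *)
Section operators.
Context {R : realType} (I : choiceType) (p : R) (p1 : 1 <= p).
Local Notation op := (lp I p1 -> lp I p1).

Definition bounded_op : set op := [set T | linear T /\
  exists M : R, forall xi, lp_norm (T xi) <= M * lp_norm xi].

(* Only meaningful on [bounded_op]: [sup] of an unbounded set is 0. *)
Definition op_norm (T : op) : R :=
  sup [set lp_norm (T xi) | xi in [set xi | lp_norm xi <= 1]].

Definition norm_closure (A : set op) : set op :=
  [set T | bounded_op T /\
    forall e : R, 0 < e -> exists2 S, A S & op_norm (T - S) < e].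

Definition lin_span (A : set op) : set op :=
  [set T | exists (n : nat) (c : 'I_n -> R[i]) (S : 'I_n -> op),
    (forall k, A (S k)) /\ T = \sum_(k < n) c k *: S k].

Definition mult_ops (F : set (I -> R[i])) : set op :=
  [set T | exists2 f, F f &
    forall (xi : lp I p1) (i : I), T xi i = f i * xi i].

Definition entry (T : op) (x y : I) : R[i] := T (delta p1 y) x.

Definition linfty : set (I -> R[i]) :=
  [set f | exists M : R, forall i, normc (f i) <= M].

End operators.

Arguments mult_ops {R I p} p1 F.
Arguments linfty {R} I.

Section tensor_algebras.
Context {R : realType} (I J : choiceType) (p : R) (p1 : 1 <= p).

(* A bounded operator c satisfying this is unique, because finitely supported
   functions are dense in l^p (p < oo). *)
Definition is_tensor_op (a : lp I p1 -> lp I p1) (b : lp J p1 -> lp J p1)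
    (c : lp (I * J)%type p1 -> lp (I * J)%type p1) :=
  bounded_op c /\
  forall xi eta, c (tensor_vec xi eta) = tensor_vec (a xi) (b eta).

Definition tensor_alg (A : set (lp I p1 -> lp I p1))
    (B : set (lp J p1 -> lp J p1)) :=
  norm_closure (lin_span
    [set c | exists a b, [/\ A a, B b & is_tensor_op a b c]]).

End tensor_algebras.

Section Roe_algebras.
Context {R : realType} (p : R) (p1 : 1 <= p).

(* The supremum over the empty set (T = 0) is -oo, hence < +oo. *)
Definition propagation (X : metricType R) (T : lp X p1 -> lp X p1) : \bar R :=
  ereal_sup [set (mdist z.1 z.2)%:E | z in [set z | entry T z.1 z.2 != 0]].

Definition uniform_Roe (X : metricType R) : set (lp X p1 -> lp X p1) :=
  norm_closure [set T | bounded_op T /\ (propagation T < +oo)%E].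

Definition matrix_op n (A : 'M[R[i]]_n) (xi : lp nat p1) : lp nat p1 :=
  \sum_(i < n) (\sum_(j < n) A i j * xi j) *: delta p1 (i : nat).

Definition Minfty : set (lp nat p1 -> lp nat p1) :=
  norm_closure [set T | exists n (A : 'M[R[i]]_n), T = matrix_op A].

Definition c0 : set (nat -> R[i]) :=
  [set f | normc (f n) @[n --> \oo] --> (0 : R)].

Definition stable_Roe (X : metricType R) := tensor_alg (@uniform_Roe X) Minfty.

Definition stable_Cartan (X : metricType R) :=
  tensor_alg (mult_ops p1 (linfty X)) (mult_ops p1 c0).

End Roe_algebras.

Arguments uniform_Roe {R p} p1 X.
Arguments Minfty {R p} p1.
Arguments stable_Roe {R p} p1 X.
Arguments stable_Cartan {R p} p1 X.

(* An isomorphism between algebras A and B of operators is represented by a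
   function on all operators, of which only the values on A matter. *)
Record isometric_iso {R : realType} (I J : choiceType) (p : R) (p1 : 1 <= p)
    (A : set (lp I p1 -> lp I p1)) (B : set (lp J p1 -> lp J p1))
    (phi : (lp I p1 -> lp I p1) -> (lp J p1 -> lp J p1)) : Prop :=
  IsometricIso {
    iso_bij : set_bij A B phi ;
    iso_linear : forall (c : R[i]) a b, A a -> A b ->
      phi (c *: a + b) = c *: phi a + phi b ;
    iso_mul : forall a b, A a -> A b -> phi (a \o b) = phi a \o phi b ;
    iso_isometry : forall a, A a -> op_norm (phi a) = op_norm a }.

(* Main.v *)
(* Both algebras over X are norm closures of operators on l^p(X * nat) whose
   matrices live in bands: {d(x, y) <= r; i, j < n} for B_u(X) (x) M_oo, and
   the part i < n of the diagonal for the Cartan subalgebra. Coarse equivalence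
   amounts to a bijection F : X * nat -> Y * nat that, like its inverse, maps
   bands into bands. A coarse equivalence f has fibers of uniformly bounded
   size, so (x, n) |-> (f x, n N + index of x in its fiber) is injective, and
   Cantor-Bernstein combines two such injections into F. Conjugation by F is
   then an isometric isomorphism respecting the Cartan subalgebras.

   Conversely, let phi be an isometric isomorphism. If phi respects the Cartan
   subalgebras, it permutes their minimal idempotents, the diagonal matrix units.
   If p <> 2 it does so anyway: call an idempotent e hermitian when 1 + (z - 1) e
   acts isometrically for every |z| = 1, a notion phi preserves; the equality
   case of Clarkson's inequality forces these isometries to keep the images of
   distinct basis vectors disjointly supported, which makes e diagonal. Hence
   phi (e_a) = e_(F a) for a bijection F, and since the norm of e_a T e_b is
   |T_ab|, phi preserves moduli of entries along F. Applied to the 0-1 matrix of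
   a band, whose image lies within 1/2 of a banded operator, this shows that F
   maps bands into bands. *)

Require Import Defs.
From HB Require Import structures.
From mathcomp Require Import all_boot all_order all_algebra.
From mathcomp Require Import all_classical all_reals all_analysis.
From mathcomp Require Import complex ring lra.

Set Implicit Arguments.
Unset Strict Implicit.
Unset Printing Implicit Defensive.

Import Order.TTheory GRing.Theory Num.Theory.
Import numFieldNormedType.Exports.

Local Open Scope classical_set_scope.
Local Open Scope ring_scope.
Local Open Scope complex_scope.

(** * The norm of l^p(I) *)

(* Locked, since unification would otherwise unfold norms down to the
   construction of the real exponential. *)
HB.lock Definition lpn {R : realType} {I : choiceType} {p : R} {p1 : 1 <= p}
  (xi : lp I p1) : R := lp_norm xi.

Lemma lpnE {R : realType} {I : choiceType} {p : R} {p1 : 1 <= p} (xi : lp I p1) :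
  lp_norm xi = lpn xi.
Proof. by rewrite unlock. Qed.

Section lp_norm_theory.
Context {R : realType} (p : R) (p1 : 1 <= p).

Lemma p_gt0 : 0 < p. Proof. exact: lt_le_trans p1. Qed.

Lemma p_neq0 : p != 0. Proof. exact: lt0r_neq0 p_gt0. Qed.

Lemma powR_invVK (x : R) : 0 <= x -> (x `^ p^-1) `^ p = x.
Proof. by move=> x0; rewrite -powRrM mulVf ?p_neq0// powRr1. Qed.

Lemma powR_p_le (x y : R) : 0 <= x -> 0 <= y -> (x `^ p <= y `^ p) = (x <= y).
Proof.
move=> x0 y0; have pp := p_gt0; apply/idP/idP => [h|h].
  rewrite leNgt; apply/negP => yx; move: h; rewrite leNgt.
  by rewrite gt0_ltr_powR ?nnegrE.
by rewrite ge0_ler_powR ?nnegrE// ltW.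
Qed.

Lemma powR_p_lt (x y : R) : 0 <= x -> 0 <= y -> (x `^ p < y `^ p) = (x < y).
Proof. by move=> x0 y0; rewrite !ltNge powR_p_le. Qed.

Lemma normc_ge0 (z : R[i]) : 0 <= normc z.
Proof. by case: z => a b; exact: sqrtr_ge0. Qed.

Lemma normcN (z : R[i]) : normc (- z) = normc z.
Proof. by case: z => a b /=; rewrite !sqrrN. Qed.

Lemma normc1 : normc (1 : R[i]) = 1.
Proof. by rewrite /= expr1n expr0n addr0 sqrtr1. Qed.

Lemma lp_sum_ge0 (I : choiceType) (f : I -> R[i]) : (0 <= lp_sum p f)%E.
Proof. by apply: esum_ge0 => i _; rewrite lee_fin powR_ge0. Qed.

Section basic.
Context {I : choiceType}.
Implicit Types xi eta : lp I p1.

Lemma lp_ext xi eta : xi =1 eta -> xi = eta.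
Proof. by move=> e; apply: val_inj; apply/funext. Qed.

Lemma lp_addE xi eta i : (xi + eta) i = xi i + eta i.
Proof. by []. Qed.

Lemma lp_oppE xi i : (- xi) i = - xi i.
Proof. by []. Qed.

Lemma lp_zeroE i : (0 : lp I p1) i = 0.
Proof. by []. Qed.

Lemma lp_scaleE (c : R[i]) xi i : (c *: xi) i = c * xi i.
Proof. by []. Qed.

Lemma lp_deltaE (i j : I) : delta p1 j i = (i == j)%:R.
Proof. by []. Qed.

Lemma lp_sumrE (S : Type) (r : seq S) (P : pred S) (F : S -> lp I p1) i :
  (\sum_(s <- r | P s) F s) i = \sum_(s <- r | P s) F s i.
Proof.
by elim/big_rec2: _ => [|s y x _ <-]; rewrite ?lp_zeroE ?lp_addE.
Qed.

Lemma lp_sumE xi : lp_sum p xi = (lpn xi `^ p)%:E.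
Proof.
have xifin : lp_sum p xi \is a fin_num.
  by case: xi => f /asboolP ff /=; rewrite ge0_fin_numE// lp_sum_ge0.
by rewrite -lpnE /lp_norm powR_invVK ?fine_ge0 ?lp_sum_ge0// fineK.
Qed.

Lemma lpn_ge0 xi : 0 <= lpn xi.
Proof. by rewrite -lpnE powR_ge0. Qed.

Lemma lpn_fine xi : lpn xi = fine (lp_sum p xi) `^ p^-1.
Proof. by rewrite -lpnE. Qed.

Lemma lpn_eq (J : choiceType) xi (eta : lp J p1) :
  lp_sum p xi = lp_sum p eta -> lpn xi = lpn eta.
Proof. by rewrite -!lpnE /lp_norm => ->. Qed.

End basic.


Section compare.
Context {I : choiceType}.
Implicit Types xi : lp I p1.

Lemma lpn_le (J : choiceType) (M : R) xi (eta : lp J p1) : 0 <= M ->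
  (lp_sum p xi <= (M `^ p)%:E * lp_sum p eta)%E ->
  lpn xi <= M * lpn eta.
Proof.
move=> M0; rewrite !lp_sumE -EFinM lee_fin -powRM ?lpn_ge0//.
by rewrite powR_p_le ?mulr_ge0 ?lpn_ge0.
Qed.

Lemma lp_sum_le (J : choiceType) (M : R) xi (eta : lp J p1) : 0 <= M ->
  lpn xi <= M * lpn eta ->
  (lp_sum p xi <= (M `^ p)%:E * lp_sum p eta)%E.
Proof.
move=> M0 h; rewrite !lp_sumE -EFinM lee_fin -powRM ?lpn_ge0//.
by rewrite powR_p_le ?mulr_ge0 ?lpn_ge0.
Qed.

Lemma lp_coord_le xi i : normc (xi i) <= lpn xi.
Proof.
have : ((normc (xi i) `^ p)%:E <= lp_sum p xi)%E.
  rewrite /lp_sum (esumID [set i]) => [|j _]; last by rewrite lee_fin powR_ge0.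
  rewrite setTI esum_set1 ?lee_fin ?powR_ge0// leeDl//.
  by apply: esum_ge0 => j _; rewrite lee_fin powR_ge0.
by rewrite lp_sumE lee_fin powR_p_le ?normc_ge0 ?lpn_ge0.
Qed.

End compare.

Section normed.
Context {I : choiceType}.
Implicit Types xi eta : lp I p1.

Lemma lpn0 : lpn (0 : lp I p1) = 0.
Proof.
rewrite lpn_fine /lp_sum esum1 ?powR0 ?invr_neq0 ?p_neq0// => i _.
by rewrite lp_zeroE normc0 powR0 ?p_neq0.
Qed.

Lemma lpn_le0_eq0 xi : lpn xi <= 0 -> xi = 0.
Proof.
move=> h; apply: lp_ext => i; apply: eq0_normc; apply/eqP.
by rewrite eq_le normc_ge0 (le_trans (lp_coord_le _ _)).
Qed.

Lemma lpnZ (c : R[i]) xi : lpn (c *: xi) = normc c * lpn xi.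
Proof.
(* One inequality suffices: applied to [c^-1] and [c *: xi] it gives the other. *)
have scale_le a (zeta : lp I p1) : lpn (a *: zeta) <= normc a * lpn zeta.
  apply: lpn_le; first exact: normc_ge0.
  rewrite /lp_sum; under eq_esum => i _ do
    rewrite lp_scaleE normcM powRM ?normc_ge0// EFinM.
  apply: ge_ereal_sup => _ [F FI <-].
  rewrite -ge0_mule_fsumr; last by move=> i; rewrite lee_fin powR_ge0.
  apply: lee_wpmul2l; first by rewrite lee_fin powR_ge0.
  by apply: ereal_sup_ubound; exists F.
have [->|c0] := eqVneq c 0; first by rewrite scale0r lpn0 normc0 mul0r.
apply/eqP; rewrite eq_le scale_le/=.
have nc0 : 0 < normc c.
  rewrite lt_neqAle normc_ge0 andbT eq_sym; apply: contra c0 => /eqP.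
  by move=> /eq0_normc ->.
have := scale_le c^-1 (c *: xi); rewrite scalerA mulVf// scale1r.
have -> : normc c^-1 = (normc c)^-1.
  apply: (mulfI (lt0r_neq0 nc0)); rewrite -normcM !mulfV ?normc1//.
  exact: lt0r_neq0.
by rewrite mulrC ler_pdivlMr// mulrC.
Qed.

Lemma lpn_delta (i : I) : lpn (delta p1 i) = 1.
Proof.
apply/eqP; rewrite eq_le; apply/andP; split; last first.
  by have := lp_coord_le (delta p1 i) i; rewrite lp_deltaE eqxx normc1.
rewrite lpn_fine /lp_sum (esumID [set i]) => [|j _];
  last by rewrite lee_fin powR_ge0.
rewrite setTI esum_set1 ?lee_fin ?powR_ge0// [X in (_ + X)%E]esum1 => [|j [_ ji]].
  by rewrite lp_deltaE eqxx normc1 addr0 !powR1.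
by move/eqP/negbTE : ji; rewrite lp_deltaE => ->; rewrite normc0 powR0// p_neq0.
Qed.

(* Minkowski's inequality up to a constant, which is all that the closure
   arguments need. *)
Lemma lpn_quasiD xi eta : lpn (xi + eta) <= 4 * (lpn xi + lpn eta).
Proof.
have [m [m0 xim etam mle]] : exists m : R, [/\ 0 <= m, lpn xi <= m,
    lpn eta <= m & m <= lpn xi + lpn eta].
  exists (lpn xi + lpn eta).
  by split; [rewrite addr_ge0 ?lpn_ge0|rewrite lerDl lpn_ge0
            |rewrite lerDr lpn_ge0|].
suff : lpn (xi + eta) <= 4 * m.
  by move=> /le_trans; apply; rewrite ler_wpM2l.
have h : (lp_sum p (xi + eta)%R <= ((4 * m) `^ p)%:E)%E.
  apply: (@le_trans _ _ ((2 `^ p)%:E * (lp_sum p xi + lp_sum p eta))%E).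
    rewrite /lp_sum -esumD; [|by move=> *; rewrite lee_fin powR_ge0..].
    apply: (@le_trans _ _ (\esum_(i in [set: I]) ((2 `^ p)%:E *
        ((normc (xi i) `^ p)%:E + (normc (eta i) `^ p)%:E))%E)).
      apply: le_esum => i _; rewrite -EFinD -EFinM lee_fin lp_addE.
      set u := xi i; set v := eta i.
      have uv : normc (u + v) <= 2 * Num.max (normc u) (normc v).
        rewrite (le_trans (le_normcD _ _))// mulr2n mulrDl mul1r.
        by rewrite lerD// le_max lexx// orbT.
      apply: (@le_trans _ _ ((2 * Num.max (normc u) (normc v)) `^ p)).
        by rewrite powR_p_le ?mulr_ge0 ?le_max ?normc_ge0.
      rewrite powRM// ?le_max ?normc_ge0// ler_wpM2l ?powR_ge0//.
      by case: (leP (normc u)) => _; rewrite ?lerDl ?lerDr powR_ge0.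
    apply: ge_ereal_sup => _ [F FI <-].
    rewrite -ge0_mule_fsumr; last by move=> i; rewrite -EFinD lee_fin addr_ge0 ?powR_ge0.
    apply: lee_wpmul2l; first by rewrite lee_fin powR_ge0.
    by apply: ereal_sup_ubound; exists F.
  rewrite !lp_sumE -EFinD -EFinM lee_fin.
  (* One factor 2 comes from bounding a sum by twice the maximum, the other from 2 m^p <= (2 m)^p,
     which uses p >= 1. *)
  have -> : (4 : R) = 2 * 2 by ring.
  rewrite -mulrA powRM ?mulr_ge0// ler_wpM2l ?powR_ge0//.
  have mp (t : R) : 0 <= t -> t <= m -> t `^ p <= m `^ p.
    by move=> t0 tm; rewrite powR_p_le.
  apply: (@le_trans _ _ (2 * m `^ p)).
    by rewrite mulr_natl mulr2n lerD// mp ?lpn_ge0.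
  rewrite powRM// ler_wpM2r ?powR_ge0// -[leLHS]powRr1//.
  by apply: ler_powR => //; rewrite ler1n.
by move: h; rewrite lp_sumE lee_fin powR_p_le ?mulr_ge0 ?lpn_ge0.
Qed.

(** Density of the finitely supported vectors. A finite set [F] that carries the p-th power sum up
    to e^p leaves a tail of norm less than e. *)
Lemma lp_approx xi (e : R) : 0 < e -> exists F : seq I,
  lpn (xi - \sum_(b <- F) xi b *: delta p1 b) < e.
Proof.
move=> e0.
have ep0 : 0 < e `^ p by rewrite powR_gt0.
have sfin : lp_sum p xi \is a fin_num by rewrite lp_sumE.
have [_ [F [Ffin _]] <- hF] := ub_ereal_sup_adherent ep0 sfin.
have Funiq := finmap.fset_uniq (fset_set F).
have FE i : (i \in finmap.enum_fset (fset_set F)) = (i \in F).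
  by rewrite -(in_fset_set Ffin).
exists (finmap.enum_fset (fset_set F)).
set tail := (X in lpn X).
have tailE i : tail i = if i \in F then 0 else xi i.
  rewrite /tail lp_addE lp_oppE lp_sumrE.
  have -> : \sum_(s <- finmap.enum_fset (fset_set F)) (xi s *: delta p1 s) i =
      if i \in F then xi i else 0.
    case: ifPn => iF.
      rewrite (bigD1_seq i) ?FE// big1 => [|j ji].
        by rewrite lp_scaleE lp_deltaE eqxx mulr1; exact: addr0.
      by rewrite lp_scaleE lp_deltaE eq_sym (negbTE ji) mulr0.
    rewrite big_seq big1// => j jF; rewrite lp_scaleE lp_deltaE.
    case: eqP => [ij|]; last by rewrite mulr0.
    by move: jF; rewrite -ij FE (negbTE iF).
  by case: ifPn; rewrite ?subrr ?subr0.
have split : lp_sum p xi = (\sum_(i \in F) (normc (xi i) `^ p)%:E + lp_sum p tail)%E.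
  rewrite /lp_sum (esumID F) => [|i _]; last by rewrite lee_fin powR_ge0.
  rewrite setTI esum_fset//; last by move=> *; rewrite lee_fin powR_ge0.
  congr (_ + _)%E; rewrite setTI esum_mkcond; apply: eq_esum => i _.
  rewrite in_setC tailE; case: (i \in F) => //.
  by rewrite normc0 powR0 ?p_neq0.
have Sfin : (\sum_(i \in F) (normc (xi i) `^ p)%:E)%E \is a fin_num.
  by rewrite fsbig_finite// sumEFin.
have : (lp_sum p tail < (e `^ p)%:E)%E.
  move: hF; rewrite -[ereal_sup _]/(lp_sum p xi) split.
  have cancel (S : \bar R) (a t : R) : S \is a fin_num ->
      (S + a%:E - t%:E < S)%E -> (a%:E < t%:E)%E.
    by case: S => // r _; rewrite -!EFinD !lte_fin ltrBlDr ltrD2l.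
  by rewrite lp_sumE; exact: cancel.
by rewrite lp_sumE lte_fin powR_p_lt ?lpn_ge0// ltW.
Qed.

End normed.
End lp_norm_theory.

(** * Bounded operators and norm closures *)

(* A record rather than a bare universally quantified inequality, because
   automation would try to unify the latter with every inequality in sight. *)
Record op_bound {R : realType} {p : R} {p1 : 1 <= p} {I J : choiceType}
    (T : lp I p1 -> lp J p1) (M : R) : Prop := OpBound {
  op_boundP :> forall xi, lpn (T xi) <= M * lpn xi }.

HB.lock Definition opn {R : realType} {p : R} {p1 : 1 <= p} {I : choiceType}
  (T : lp I p1 -> lp I p1) : R := op_norm T.

(* Boundedness, again as a record to keep automation from unfolding it. *)
Record bop {R : realType} {p : R} {p1 : 1 <= p} {I : choiceType}
    (T : lp I p1 -> lp I p1) : Prop := Bop { bop_bounded : bounded_op T }.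

Section operator_theory.
Context {R : realType} {p : R} {p1 : 1 <= p} {I : choiceType}.
Local Notation op := (lp I p1 -> lp I p1).
Implicit Types (T S : op) (xi eta : lp I p1).

Lemma bopP T : bop T -> exists2 M : R, 0 <= M & op_bound T M.
Proof.
move=> [[_ [M MT]]]; exists `|M| => //; split=> xi.
rewrite -!lpnE; apply: le_trans (MT xi) _.
by rewrite ler_wpM2r ?lpnE ?lpn_ge0// ler_norm.
Qed.

Section linearity.
Context (T : op) (bT : bop T).

Lemma bop_linear (c : R[i]) xi eta : T (c *: xi + eta) = c *: T xi + T eta.
Proof. by case: bT => -[linT _]; exact: linT. Qed.

Lemma bopD xi eta : T (xi + eta) = T xi + T eta.
Proof. by rewrite -[xi]scale1r bop_linear !scale1r. Qed.

Lemma bop0 : T 0 = 0.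
Proof. by apply: (addrI (T 0)); rewrite -bopD !addr0. Qed.

Lemma bopZ (c : R[i]) xi : T (c *: xi) = c *: T xi.
Proof. by rewrite -[c *: xi]addr0 bop_linear bop0 addr0. Qed.

Lemma bopB xi eta : T (xi - eta) = T xi - T eta.
Proof. by rewrite -scaleN1r bopD bopZ scaleN1r. Qed.

Lemma bop_sum (A : Type) (r : seq A) (F : A -> lp I p1) :
  T (\sum_(a <- r) F a) = \sum_(a <- r) T (F a).
Proof.
elim: r => [|a r ih]; first by rewrite !big_nil bop0.
by rewrite !big_cons bopD ih.
Qed.

End linearity.

Lemma bop_of_bound T (M : R) : linear T ->
  op_bound T M -> bop T.
Proof. by move=> linT MT; do 2!split=> //; exists M => xi; rewrite !lpnE; exact: MT. Qed.

Lemma bop_lin T S (c : R[i]) :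
  bop T -> bop S -> bop (c *: T + S).
Proof.
move=> bT bS.
have [M M0 MT] := bopP bT; have [N N0 NS] := bopP bS.
apply: (@bop_of_bound _ (4 * (normc c * M + N))) => [a xi eta|]; last split=> xi.
  rewrite -[LHS]/(c *: T _ + S _) -[RHS]/(a *: (c *: T _ + S _) + (c *: T _ + S _)).
  rewrite (bop_linear bT) (bop_linear bS) !scalerDr !scalerA [a * c]mulrC.
  by rewrite addrACA.
rewrite -[X in lpn X]/(c *: T xi + S xi).
apply: le_trans (lpn_quasiD _ _) _; rewrite lpnZ.
have h1 := ler_wpM2l (normc_ge0 c) (MT xi).
by rewrite -[leRHS]mulrA ler_pM2l// mulrDl -mulrA lerD// op_boundP.
Qed.

Lemma bop_zero : bop (0 : op).
Proof.
apply: (@bop_of_bound _ 0) => [a xi eta|]; last by split=> xi; rewrite lpn0 mul0r.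
by rewrite -[LHS]/(0 : lp I p1) -[RHS]/(a *: 0 + 0 : lp I p1) scaler0 addr0.
Qed.

Lemma bop_add T S : bop T -> bop S -> bop (T + S).
Proof. by move=> bT bS; have := bop_lin 1 bT bS; rewrite scale1r. Qed.

Lemma bop_scale T (c : R[i]) : bop T -> bop (c *: T).
Proof.
by move=> bT; have := bop_lin c bT bop_zero; rewrite addr0.
Qed.

Lemma bop_sub T S : bop T -> bop S -> bop (T - S).
Proof.
by move=> bT bS; apply: bop_add => //; rewrite -scaleN1r; exact: bop_scale.
Qed.

Lemma bop_bigsum (A : Type) (r : seq A) (F : A -> op) :
  (forall a, bop (F a)) -> bop (\sum_(a <- r) F a).
Proof.
by move=> bF; elim/big_rec: _ => [|a S _]; [exact: bop_zero|exact: bop_add].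
Qed.

Lemma bop_comp T S : bop T -> bop S -> bop (T \o S).
Proof.
move=> bT bS.
have [M M0 MT] := bopP bT; have [N N0 NS] := bopP bS.
apply: (@bop_of_bound _ (M * N)) => [a xi eta|]; last split=> xi.
  by rewrite -[LHS]/(T (S _)) (bop_linear bS) (bop_linear bT).
by apply: le_trans (MT _) _; rewrite -mulrA ler_wpM2l// op_boundP.
Qed.

Lemma opnE T : op_norm T = opn T.
Proof. by rewrite unlock. Qed.

Lemma opn_sup T : opn T = sup [set lpn (T xi) | xi in [set xi | lpn xi <= 1]].
Proof.
rewrite -opnE /op_norm; congr sup; apply/seteqP.
by split=> _ [xi /= h <-]; exists xi; rewrite /= ?lpnE// -lpnE.
Qed.

(** A nonzero [xi] is scaled to norm 1; boundedness of [T] makes [sup] a genuine least upper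
    bound. *)
Lemma opn_ub T xi : bop T -> lpn (T xi) <= opn T * lpn xi.
Proof.
move=> bT; have [M M0 MT] := bopP bT.
have hub : has_ubound [set lpn (T xi) | xi in [set xi | lpn xi <= 1]].
  exists M => _ [zeta /= z1 <-]; apply: le_trans (MT _) _.
  by rewrite -[leRHS]mulr1 ler_wpM2l.
have [xi0|xi0] := leP (lpn xi) 0.
  by rewrite (lpn_le0_eq0 xi0) (bop0 bT) lpn0 mulr0.
set c : R[i] := ((lpn xi)^-1)%:C.
have nc : normc c = (lpn xi)^-1.
  rewrite /= expr0n addr0 sqrtr_sqr ger0_norm// invr_ge0 ltW//.
rewrite -ler_pdivrMr// mulrC.
have -> : (lpn xi)^-1 * lpn (T xi) = lpn (T (c *: xi)).
  by rewrite (bopZ bT) lpnZ nc.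
rewrite opn_sup; apply: ub_le_sup => //; exists (c *: xi) => //=.
by rewrite lpnZ nc mulVf// lt0r_neq0.
Qed.

Lemma opn_le T (M : R) : 0 <= M -> op_bound T M -> opn T <= M.
Proof.
move=> M0 MT; rewrite opn_sup; apply: ge_sup.
  by exists (lpn (T 0)), 0 => //=; rewrite lpn0.
move=> _ [xi /= xi1 <-]; apply: le_trans (MT _) _.
by rewrite -[leRHS]mulr1 ler_wpM2l.
Qed.

Lemma opn_ge0 T : bop T -> 0 <= opn T.
Proof.
move=> bT; rewrite leNgt; apply/negP => T0.
have Tnull xi : lpn (T xi) <= 0 * lpn xi.
  apply: le_trans (opn_ub _ bT) _.
  by rewrite ler_wpM2r ?lpn_ge0// ltW.
have T00 xi : T xi = 0 by apply: lpn_le0_eq0; have := Tnull xi; rewrite mul0r.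
move: T0; rewrite opn_sup (_ : [set _ | _ in _] = [set 0]) ?sup1 ?ltxx//.
apply/seteqP; split=> [_ [xi _ <-]|_ ->] /=; first by rewrite T00 lpn0.
by exists 0; rewrite ?T00 /= lpn0.
Qed.

Lemma eq_opn T S : (forall xi, lpn (T xi) = lpn (S xi)) ->
  opn T = opn S.
Proof. by move=> TS; rewrite !opn_sup; congr (sup _); apply: eq_imagel => xi _. Qed.

Lemma entry_le_opn T a b : bop T -> normc (entry T a b) <= opn T.
Proof.
move=> bT; apply: le_trans (lp_coord_le _ _) _.
by apply: le_trans (opn_ub _ bT) _; rewrite lpn_delta mulr1.
Qed.

(* Finitely supported vectors are dense, so a matrix row annihilating [xi]
   termwise annihilates it. *)
Lemma bop_coord_eq0 T xi a : bop T ->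
  (forall b, entry T a b * xi b = 0) -> T xi a = 0.
Proof.
move=> bT Tab; have [M M0 MT] := bopP bT.
apply: eq0_normc; apply/eqP; rewrite eq_le normc_ge0 andbT.
apply/ler_addgt0Pr => e e0; rewrite add0r.
have M10 : 0 < M + 1 by rewrite ltr_wpDl.
have [F hF] := lp_approx xi (divr_gt0 e0 M10).
set fin := (X in xi - X) in hF.
have Tfin : T fin a = 0.
  rewrite (bop_sum bT) lp_sumrE big1// => b _.
  by rewrite (bopZ bT) lp_scaleE mulrC; exact: Tab.
have -> : T xi a = T (xi - fin) a by rewrite (bopB bT) lp_addE lp_oppE Tfin subr0.
apply: le_trans (lp_coord_le _ _) _; apply: le_trans (MT _) _.
apply: (@le_trans _ _ ((M + 1) * (e / (M + 1)))).
  by apply: ler_pM; rewrite ?lpn_ge0 ?lerDl// ltW.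
by rewrite mulrCA mulfV ?mulr1// lt0r_neq0.
Qed.

Lemma bop_ext T S : bop T -> bop S ->
  (forall a b, entry T a b = entry S a b) -> T = S.
Proof.
move=> bT bS TS; apply/funext => xi; apply: lp_ext => a.
apply/eqP; rewrite -subr_eq0; apply/eqP.
rewrite -[LHS]/((T - S) xi a); apply: bop_coord_eq0; first exact: bop_sub.
by move=> b; rewrite -[entry _ _ _]/(entry T a b - entry S a b) TS subrr mul0r.
Qed.

(** Replaces the condition on [op_norm], a supremum, by a pointwise bound. On the way back,
    approximating within e / 2 makes the inequality strict again. *)
Lemma norm_closureP (A : set op) T : A `<=` bop ->
  norm_closure A T <-> bop T /\ forall e : R, 0 < e ->
    exists2 S, A S & op_bound (T - S) e.
Proof.
move=> bA; split=> -[bT TA].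
  have {}bT : bop T by split.
  split=> // e e0.
  have [S AS TS] := TA e e0; exists S => //; split=> xi.
  rewrite opnE in TS.
  apply: (le_trans (opn_ub xi (bop_sub bT (bA _ AS)))).
  by rewrite ler_wpM2r ?lpn_ge0// ltW.
split=> [|e e0]; first exact: bop_bounded.
have e20 : 0 < e / 2 by rewrite divr_gt0.
have [S AS TS] := TA _ e20; exists S => //.
rewrite opnE; apply: (@le_lt_trans _ _ (e / 2)); first by apply: opn_le => //; exact: ltW.
by rewrite ltr_pdivrMr// ltr_pMr// ltr1n.
Qed.

Lemma norm_closure_bounded (A : set op) : norm_closure A `<=` bop.
Proof. by move=> T [bT _]; split. Qed.

Lemma sub_norm_closure (A : set op) : A `<=` bop -> A `<=` norm_closure A.
Proof.
move=> bA T AT; apply/(norm_closureP _ bA); split; first exact: bA.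
move=> e e0; exists T => //; split=> xi; rewrite -[X in lpn X]/(T xi - T xi) subrr lpn0.
by rewrite mulr_ge0 ?lpn_ge0// ltW.
Qed.

Lemma norm_closure_sub (A B : set op) :
  A `<=` bop -> B `<=` bop ->
  A `<=` norm_closure B -> norm_closure A `<=` norm_closure B.
Proof.
move=> bA bB AB T /(norm_closureP _ bA)[bT TA].
apply/(norm_closureP _ bB); split=> // e e0.
(* Two errors of e / 8 add up to e under the quasi-triangle inequality with constant 4. *)
have e80 : 0 < e / 8 by rewrite divr_gt0.
have [S /AB/(norm_closureP _ bB)[bS SB] TS] := TA _ e80.
have [U BU SU] := SB _ e80; exists U => //; split=> xi.
have -> : (T - U) xi = (T xi - S xi) + (S xi - U xi).
  by rewrite addrA subrK.
apply: le_trans (lpn_quasiD _ _) _.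
have := lerD (TS xi) (SU xi); have := lpn_ge0 xi; lra.
Qed.

Lemma norm_closure_lin (A : set op) : A `<=` bop ->
  (forall (c : R[i]) T S, A T -> A S -> A (c *: T + S)) ->
  forall (c : R[i]) T S, norm_closure A T -> norm_closure A S ->
  norm_closure A (c *: T + S).
Proof.
move=> bA linA c T S /(norm_closureP _ bA)[bT TA] /(norm_closureP _ bA)[bS SA].
apply/(norm_closureP _ bA); split=> [|e e0]; first exact: bop_lin.
have nc := normc_ge0 c.
have k0 : 0 < 4 * (normc c + 1) by lra.
have ek0 : 0 < e / (4 * (normc c + 1)) by rewrite divr_gt0.
have [T' AT TT] := TA _ ek0; have [S' AS SS] := SA _ ek0.
exists (c *: T' + S') ; first exact: linA.
split=> xi.
rewrite -[X in lpn X]/(c *: T xi + S xi - (c *: T' xi + S' xi)).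
rewrite opprD addrACA -scalerBr.
apply: le_trans (lpn_quasiD _ _) _; rewrite lpnZ.
have h1 := ler_wpM2l nc (TT xi).
set d := e / _ in h1 SS; have de : d * (4 * (normc c + 1)) = e.
  by rewrite divfK// lt0r_neq0.
apply: (@le_trans _ _ (4 * (normc c * (d * lpn xi) + d * lpn xi))).
  by rewrite ler_pM2l//; apply: lerD; [exact: h1|exact: (SS xi)].
by rewrite -de le_eqVlt; apply/orP; left; apply/eqP; ring.
Qed.

Lemma norm_closure_comp (A : set op) : A `<=` bop ->
  (forall T S, A T -> A S -> A (T \o S)) ->
  forall T S, norm_closure A T -> norm_closure A S -> norm_closure A (T \o S).
Proof.
move=> bA compA T S /(norm_closureP _ bA)[bT TA] /(norm_closureP _ bA)[bS SA].
apply/(norm_closureP _ bA); split=> [|e e0]; first exact: bop_comp.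
have [M M0 MT] := bopP bT.
have k0 : 0 < 8 * (M + 1) by lra.
have ek0 : 0 < e / (8 * (M + 1)) by rewrite divr_gt0.
(* [S'] is chosen before [T'], because its bound [N] decides how closely [T] has to be approximated
   in T S - T' S' = T (S - S') + (T - T') S'. *)
have [S' AS SS] := SA _ ek0.
have [N N0 NS] := bopP (bA _ AS).
have l0 : 0 < 8 * (N + 1) by lra.
have el0 : 0 < e / (8 * (N + 1)) by rewrite divr_gt0.
have [T' AT TT] := TA _ el0.
exists (T' \o S') ; first exact: compA.
split=> xi.
have -> : (T \o S - (T' \o S')) xi =
    T (S xi - S' xi) + (T (S' xi) - T' (S' xi)).
  by rewrite (bopB bT) addrA subrK.
apply: le_trans (lpn_quasiD _ _) _.
have h1 : lpn (T ((S - S') xi)) <= e / 8 * lpn xi.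
  apply: le_trans (MT _) _; apply: le_trans (ler_wpM2l M0 (SS xi)) _.
  rewrite mulrA ler_wpM2r ?lpn_ge0//.
  have := divfK (lt0r_neq0 k0) e; set d := e / _ in ek0 *; nra.
have h2 : lpn ((T - T') (S' xi)) <= e / 8 * lpn xi.
  apply: le_trans (TT _) _; apply: le_trans (ler_wpM2l (ltW el0) (NS xi)) _.
  rewrite mulrA ler_wpM2r ?lpn_ge0//.
  have := divfK (lt0r_neq0 l0) e; set d := e / _ in el0 *; nra.
have := lpn_ge0 xi; lra.
Qed.

End operator_theory.

(** * Slices and tensor products *)

(* [0] when [f] is not p-summable *)
HB.lock Definition mklp {R : realType} {p : R} {p1 : 1 <= p} {I : choiceType}
  (f : I -> R[i]) : lp I p1 := insubd 0 f.

Section constructions.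
Context {R : realType} {p : R} {p1 : 1 <= p}.

Lemma mklpE {I : choiceType} (f : I -> R[i]) i :
  (lp_sum p f < +oo)%E -> (mklp f : lp I p1) i = f i.
Proof. by move=> fF; rewrite unlock -[lp_val _]/(val _) insubdK//; exact/asboolP. Qed.

Lemma lp_sum_lty {I : choiceType} (xi : lp I p1) : (lp_sum p xi < +oo)%E.
Proof. by rewrite lp_sumE ltry. Qed.

Lemma lp_dominated {I : choiceType} (f g : I -> R[i]) (M : R) : 0 <= M ->
  (forall i, normc (f i) <= M * normc (g i)) ->
  (lp_sum p f <= (M `^ p)%:E * lp_sum p g)%E.
Proof.
move=> M0 fg; apply: (@le_trans _ _
    (\esum_(i in [set: I]) ((M `^ p)%:E * (normc (g i) `^ p)%:E))%E).
  apply: le_esum => i _; rewrite -EFinM lee_fin -powRM ?normc_ge0//.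
  by rewrite powR_p_le ?mulr_ge0 ?normc_ge0.
apply: ge_ereal_sup => _ [F FI <-].
rewrite -ge0_mule_fsumr; last by move=> i; rewrite lee_fin powR_ge0.
by apply: lee_wpmul2l; [rewrite lee_fin powR_ge0|apply: ereal_sup_ubound; exists F].
Qed.

Lemma lpn_dominated {I : choiceType} (xi eta : lp I p1) (M : R) : 0 <= M ->
  (forall i, normc (xi i) <= M * normc (eta i)) -> lpn xi <= M * lpn eta.
Proof. by move=> M0 h; apply: lpn_le => //; exact: lp_dominated. Qed.

Lemma mulop_bop {I : choiceType} (T : lp I p1 -> lp I p1) (f : I -> R[i]) (M : R) :
  0 <= M -> (forall i, normc (f i) <= M) -> (forall xi i, T xi i = f i * xi i) -> bop T.
Proof.
move=> M0 fM Tf; apply: (@bop_of_bound _ _ _ _ _ M) => [c xi eta|].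
  apply: lp_ext => i; rewrite lp_addE lp_scaleE !Tf lp_addE lp_scaleE.
  by rewrite mulrDr mulrCA.
split=> xi; apply: lpn_dominated => // i.
by rewrite Tf normcM ler_wpM2r ?normc_ge0.
Qed.

Section reindexing.
Context {I J : choiceType}.

Lemma lp_sum_reindex (f : I -> R[i]) (g : J -> I) : bijective g ->
  lp_sum p (f \o g) = lp_sum p f.
Proof.
move=> [h gK hK]; rewrite /lp_sum (@reindex_esum _ _ _ [set: J] [set: I] g)//.
split=> // [x y _ _|x _]; first exact: (can_inj gK).
by exists (h x).
Qed.

Definition pull (g : J -> I) (xi : lp I p1) : lp J p1 := mklp (xi \o g).

Context (g : J -> I) (bij_g : bijective g).

Lemma pullE xi j : pull g xi j = xi (g j).
Proof. by rewrite /pull mklpE// lp_sum_reindex// lp_sum_lty. Qed.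

Lemma pull_norm xi : lpn (pull g xi) = lpn xi.
Proof.
apply: lpn_eq; rewrite -(lp_sum_reindex xi bij_g); congr (lp_sum p).
by apply/funext => j; rewrite pullE.
Qed.

Lemma pull_linear (c : R[i]) xi eta : pull g (c *: xi + eta) = c *: pull g xi + pull g eta.
Proof.
by apply: lp_ext => j; rewrite lp_addE lp_scaleE !pullE lp_addE lp_scaleE.
Qed.

Lemma pull_delta j : pull g (delta p1 (g j)) = delta p1 j.
Proof.
by apply: lp_ext => k; rewrite pullE !lp_deltaE (inj_eq (bij_inj bij_g)).
Qed.

End reindexing.

Lemma pullK {I J : choiceType} (f : I -> J) (g : J -> I) :
  cancel f g -> cancel g f -> cancel (@pull I J g) (pull f).
Proof.
move=> fK gK xi; apply: lp_ext => i; rewrite !pullE ?fK//; [by exists f|by exists g].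
Qed.

Section matrix_units.
Context {I : choiceType}.

Definition munit (a b : I) (xi : lp I p1) : lp I p1 := xi b *: delta p1 a.

Lemma op_bound_munit a b : op_bound (munit a b) 1.
Proof. by split=> xi; rewrite lpnZ lpn_delta mulr1 mul1r lp_coord_le. Qed.

Lemma bop_munit a b : bop (munit a b).
Proof.
apply: bop_of_bound (op_bound_munit a b) => c xi eta.
by rewrite /munit lp_addE lp_scaleE scalerDl scalerA.
Qed.

Lemma entry_munit a b x y : entry (munit a b) x y = ((x == a) && (y == b))%:R.
Proof.
rewrite /entry /munit lp_scaleE !lp_deltaE [b == y]eq_sym.
by case: (x == a); case: (y == b); rewrite ?mulr1 ?mul0r ?mulr0.
Qed.

End matrix_units.

Section slices.
Context {I J : choiceType}.

Lemma lp_sum_slices (f : I * J -> R[i]) :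
  lp_sum p f = (\esum_(k in [set: J]) lp_sum p (fun i => f (i, k)))%E.
Proof.
rewrite /lp_sum (@esum_esum _ _ _ _ _ (fun k i => (normc (f (i, k)) `^ p)%:E));
  last by move=> *; rewrite lee_fin powR_ge0.
rewrite (@reindex_esum _ _ _ ([set: J] `*`` (fun=> [set: I])) [set: I * J]
  (fun z => (z.2, z.1)))//.
split=> // [[a b] [c d] _ _ [-> ->]//|[a b] _].
by exists (b, a).
Qed.

Lemma lp_sum_slice_le (f : I * J -> R[i]) k :
  (lp_sum p (fun i => f (i, k)) <= lp_sum p f)%E.
Proof.
rewrite lp_sum_slices (esumID [set k]) => [|j _]; last exact: lp_sum_ge0.
rewrite setTI esum_set1 ?lp_sum_ge0// leeDl//.
by apply: esum_ge0 => j _; exact: lp_sum_ge0.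
Qed.

Definition slice (k : J) (zeta : lp (I * J)%type p1) : lp I p1 :=
  mklp (fun i => zeta (i, k)).

Lemma sliceE k zeta i : slice k zeta i = zeta (i, k).
Proof. by rewrite mklpE// (le_lt_trans (lp_sum_slice_le _ _))// lp_sum_lty. Qed.

Lemma slice_val k zeta : slice k zeta = (fun i => zeta (i, k)) :> (I -> R[i]).
Proof. by apply/funext => i; rewrite sliceE. Qed.

Lemma slice_linear k (c : R[i]) zeta eta :
  slice k (c *: zeta + eta) = c *: slice k zeta + slice k eta.
Proof. by apply: lp_ext => i; rewrite lp_addE lp_scaleE !sliceE. Qed.

Lemma slice_norm k zeta : lpn (slice k zeta) <= lpn zeta.
Proof.
rewrite -[leRHS]mul1r; apply: lpn_le => //.
by rewrite powR1 mul1e slice_val lp_sum_slice_le.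
Qed.

Lemma tensor_vecE (xi : lp I p1) (eta : lp J p1) z :
  tensor_vec xi eta z = xi z.1 * eta z.2.
Proof. by []. Qed.

Lemma slice_tensor k xi (eta : lp J p1) : slice k (tensor_vec xi eta) = eta k *: xi.
Proof. by apply: lp_ext => i; rewrite sliceE lp_scaleE mulrC. Qed.

Definition emb (k : J) (xi : lp I p1) : lp (I * J)%type p1 := tensor_vec xi (delta p1 k).

Lemma embE k xi z : emb k xi z = xi z.1 * (z.2 == k)%:R.
Proof. by []. Qed.

Lemma emb_linear k (c : R[i]) xi eta : emb k (c *: xi + eta) = c *: emb k xi + emb k eta.
Proof.
by apply: lp_ext => i; rewrite lp_addE lp_scaleE !embE lp_addE lp_scaleE mulrDl mulrA.
Qed.

Lemma emb_delta k j : emb k (delta p1 j) = delta p1 (j, k).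
Proof.
apply: lp_ext => -[x y]; rewrite embE !lp_deltaE /= xpair_eqE.
by case: (x == j); rewrite ?mul1r ?mul0r.
Qed.

Lemma emb_norm k xi : lpn (emb k xi) = lpn xi.
Proof.
apply: lpn_eq; rewrite lp_sum_slices (esumID [set k]) => [|j _]; last exact: lp_sum_ge0.
rewrite setTI esum_set1 ?lp_sum_ge0// [X in (_ + X)%E]esum1 => [|j [_ jk]].
  rewrite adde0; congr (lp_sum p); apply/funext => i.
  by rewrite embE eqxx mulr1.
rewrite /lp_sum esum1// => i _; rewrite embE.
by move/eqP/negbTE : jk => ->; rewrite mulr0 normc0 powR0// p_neq0.
Qed.

(** This is a (x) 1: [a] acts on every slice with fixed second coordinate. *)
Definition opL (a : lp I p1 -> lp I p1) (zeta : lp (I * J)%type p1) :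
  lp (I * J)%type p1 := mklp (fun z => a (slice z.2 zeta) z.1).

Lemma opL_sum_le a (M : R) zeta : 0 <= M -> op_bound a M ->
  (lp_sum p (fun z : I * J => a (slice z.2 zeta) z.1) <= (M `^ p)%:E * lp_sum p zeta)%E.
Proof.
move=> M0 aM; rewrite !lp_sum_slices.
apply: (@le_trans _ _ (\esum_(k in [set: J])
    ((M `^ p)%:E * lp_sum p (fun i => zeta (i, k))))%E).
  apply: le_esum => k _; rewrite -slice_val.
  exact: (lp_sum_le M0 (aM (slice k zeta))).
apply: ge_ereal_sup => _ [F FI <-].
rewrite -ge0_mule_fsumr; last by move=> i; exact: lp_sum_ge0.
by apply: lee_wpmul2l; [rewrite lee_fin powR_ge0|apply: ereal_sup_ubound; exists F].
Qed.

Section bounded.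
Context (a : lp I p1 -> lp I p1) (ba : bop a).

Lemma opLE zeta z : opL a zeta z = a (slice z.2 zeta) z.1.
Proof.
have [M M0 aM] := bopP ba; rewrite /opL mklpE//.
by rewrite (le_lt_trans (opL_sum_le _ M0 aM))// lp_sumE -EFinM ltry.
Qed.

Lemma op_bound_opL (M : R) : 0 <= M -> op_bound a M -> op_bound (opL a) M.
Proof.
move=> M0 aM; split=> zeta; apply: lpn_le => //.
apply: le_trans (opL_sum_le _ M0 aM); rewrite le_eqVlt; apply/orP; left.
by apply/eqP; congr (lp_sum p); apply/funext => z; rewrite opLE.
Qed.

Lemma bop_opL : bop (opL a).
Proof.
have [M M0 aM] := bopP ba.
apply: bop_of_bound (op_bound_opL M0 aM) => c xi eta.
apply: lp_ext => z; rewrite -[RHS]/(c * opL a xi z + opL a eta z) !opLE.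
by rewrite slice_linear (bop_linear ba).
Qed.

Lemma opL_tensor xi (eta : lp J p1) : opL a (tensor_vec xi eta) = tensor_vec (a xi) eta.
Proof.
by apply: lp_ext => z; rewrite opLE slice_tensor (bopZ ba) lp_scaleE mulrC.
Qed.

End bounded.

Lemma opLB a b : bop a -> bop b -> opL (a - b) = opL a - opL b.
Proof.
move=> ba bb; apply/funext => zeta; apply: lp_ext => z.
by rewrite -[RHS]/(opL a zeta z - opL b zeta z) !opLE//; exact: bop_sub.
Qed.

End slices.

Definition swap {I J : Type} (z : I * J) := (z.2, z.1).

Lemma swapK {I J : Type} : cancel (@swap I J) swap. Proof. by case. Qed.

Lemma bij_swap {I J : Type} : bijective (@swap I J).
Proof. by exists swap; exact: swapK. Qed.

Section tensor.
Context {I J : choiceType}.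

(** This is 1 (x) b, obtained from [opL] by exchanging the two factors. *)
Definition opR (b : lp J p1 -> lp J p1) (zeta : lp (I * J)%type p1) :
  lp (I * J)%type p1 := pull swap (opL b (pull swap zeta)).

Lemma op_bound_opR b (M : R) : bop b -> 0 <= M -> op_bound b M -> op_bound (opR b) M.
Proof.
move=> bb M0 bM; split=> zeta; rewrite pull_norm//; last exact: bij_swap.
apply: le_trans (op_bound_opL bb M0 bM _) _; rewrite pull_norm//; exact: bij_swap.
Qed.

Lemma bop_opR b : bop b -> bop (opR b).
Proof.
move=> bb; have [M M0 bM] := bopP bb.
apply: bop_of_bound (op_bound_opR bb M0 bM) => c xi eta.
by rewrite /opR (pull_linear bij_swap) (bop_linear (bop_opL bb)) (pull_linear bij_swap).
Qed.

Lemma pull_swap_tensor (xi : lp I p1) (eta : lp J p1) :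
  pull swap (tensor_vec xi eta) = tensor_vec eta xi.
Proof. by apply: lp_ext => z; rewrite (pullE bij_swap) !tensor_vecE mulrC. Qed.

Lemma opRB b c : bop b -> bop c -> opR (b - c) = opR b - opR c.
Proof.
move=> bb bc; apply/funext => zeta; apply: lp_ext => z.
rewrite -[RHS]/(opR b zeta z - opR c zeta z) /opR opLB//.
by rewrite !(pullE bij_swap).
Qed.

End tensor.

Section tensor_ops.
Context {I J : choiceType}.
Implicit Types (a : lp I p1 -> lp I p1) (b : lp J p1 -> lp J p1)
  (c : lp (I * J)%type p1 -> lp (I * J)%type p1) (x y : I * J).

Lemma opR_tensor b (xi : lp I p1) (eta : lp J p1) : bop b ->
  opR b (tensor_vec xi eta) = tensor_vec xi (b eta).
Proof. by move=> bb; rewrite /opR pull_swap_tensor opL_tensor// pull_swap_tensor. Qed.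

Definition tens (a : lp I p1 -> lp I p1) (b : lp J p1 -> lp J p1) := opL a \o opR b.

Lemma bop_tens a b : bop a -> bop b -> bop (tens a b).
Proof. by move=> ba bb; apply: bop_comp; [exact: bop_opL|exact: bop_opR]. Qed.

Lemma tensP a b : bop a -> bop b -> is_tensor_op a b (tens a b).
Proof.
move=> ba bb; split; first by apply: bop_bounded; exact: bop_tens.
by move=> xi eta; rewrite /tens/= opR_tensor// opL_tensor.
Qed.

Lemma entry_is_tensor_op a b c x y : is_tensor_op a b c ->
  entry c x y = entry a x.1 y.1 * entry b x.2 y.2.
Proof.
by case: x y => [i k] [j l] [_ cE]; rewrite /entry -emb_delta /emb cE.
Qed.

(** The entries of a tensor product of operators are products of entries, and a bounded operator is
    determined by its entries. *)
Lemma is_tensor_op_unique a b c : bop a -> bop b -> is_tensor_op a b c -> c = tens a b.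
Proof.
move=> ba bb cab; apply: bop_ext => [||x y]; [by split; case: cab|exact: bop_tens|].
by rewrite (entry_is_tensor_op _ _ cab) (entry_is_tensor_op _ _ (tensP ba bb)).
Qed.

(** Splits the difference as (a - a') (x) b + a' (x) (b - b'); the 4 is the constant of the
    quasi-triangle inequality. *)
Lemma tens_approx a b a' b' (M N e : R) : bop a -> bop b -> bop a' -> bop b' ->
  0 <= M -> 0 <= N -> 0 <= e -> op_bound a' M -> op_bound b N ->
  op_bound (a - a') e -> op_bound (b - b') e ->
  op_bound (tens a b - tens a' b') (4 * (M + N) * e).
Proof.
move=> ba bb ba' bb' M0 N0 e0 a'M bN aa bb_; split=> zeta.
have -> : (tens a b - tens a' b') zeta =
    opL (a - a') (opR b zeta) + opL a' (opR (b - b') zeta).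
  rewrite opLB// opRB// -[(opL a - opL a') _]/(opL a (opR b zeta) - opL a' (opR b zeta)).
  rewrite -[(opR b - opR b') _]/(opR b zeta - opR b' zeta).
  by rewrite (bopB (bop_opL ba')) addrA subrK.
apply: le_trans (lpn_quasiD _ _) _.
have h1 := op_bound_opL (bop_sub ba ba') e0 aa (opR b zeta).
have h2 := op_bound_opR bb N0 bN zeta.
have h3 := op_bound_opL ba' M0 a'M (opR (b - b') zeta).
have h4 := op_bound_opR (bop_sub bb bb') e0 bb_ zeta.
have h5 := ler_wpM2l e0 h2; have h6 := ler_wpM2l M0 h4.
have -> : 4 * (M + N) * e * lpn zeta = 4 * (e * (N * lpn zeta) + M * (e * lpn zeta)).
  by ring.
by rewrite ler_pM2l//; apply: lerD; [exact: le_trans h1 h5|exact: le_trans h3 h6].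
Qed.

End tensor_ops.
End constructions.

(** * Banded operators *)

Section banded_operators.
Context {R : realType} {p : R} {p1 : 1 <= p} {I : choiceType}.
Local Notation op := (lp I p1 -> lp I p1).
Implicit Types (T S : op) (W : I -> I -> Prop) (E : set (I -> I -> Prop)).

Lemma op_bound_le (J : choiceType) (T : lp I p1 -> lp J p1) (M N : R) :
  M <= N -> op_bound T M -> op_bound T N.
Proof.
move=> MN MT; split=> xi; apply: le_trans (MT xi) _.
by rewrite ler_wpM2r ?lpn_ge0.
Qed.

(** Bands are relations on the index set. The stabilized Roe algebra and its Cartan subalgebra both
    come from a family [E] of bands, so closure properties are proved once for such families: sums
    need [directed], products need [comp_closed]. *)
Definition supported W T := forall a b, entry T a b <> 0 -> W a b.

Definition banded E : set op := [set T | bop T /\ exists2 W, E W & supported W T].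

Definition directed E := E !=set0 /\ forall W1 W2, E W1 -> E W2 ->
  exists2 W, E W & forall a b, W1 a b \/ W2 a b -> W a b.

Definition comp_closed E := forall W1 W2, E W1 -> E W2 ->
  exists2 W, E W & forall a b c, W1 a b -> W2 b c -> W a c.

Lemma banded_bop E : banded E `<=` bop.
Proof. by move=> T []. Qed.

Lemma banded_lin E : directed E ->
  forall (c : R[i]) T S, banded E T -> banded E S -> banded E (c *: T + S).
Proof.
move=> [_ dE] c T S [bT [W1 EW1 TW1]] [bS [W2 EW2 SW2]]; split.
  exact: bop_lin.
have [W EW WW] := dE _ _ EW1 EW2; exists W => // a b.
rewrite -[entry _ _ _]/(c * entry T a b + entry S a b) => h; apply: WW.
have [T0|/TW1] := pselect (entry T a b = 0); last by left.
by right; apply: SW2 => S0; apply: h; rewrite T0 S0 mulr0 addr0.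
Qed.

Lemma banded0 E : directed E -> banded E 0.
Proof.
move=> [[W EW] _]; split; first exact: bop_zero.
by exists W => // a b h; exfalso; apply: h.
Qed.

Lemma banded_comp E : comp_closed E ->
  forall T S, banded E T -> banded E S -> banded E (T \o S).
Proof.
move=> cE T S [bT [W1 EW1 TW1]] [bS [W2 EW2 SW2]]; split.
  exact: bop_comp.
have [W EW WW] := cE _ _ EW1 EW2; exists W => // a b h.
(* No infinite matrix product has to be summed: outside [W] every term T_ac S_cb vanishes, and then
   so does the entry of the composite. *)
apply: contrapT => nW; apply: h; rewrite -[LHS]/(T (S (delta p1 b)) a).
apply: bop_coord_eq0 => // c.
have [->|/TW1 h1] := pselect (entry T a c = 0); first by rewrite mul0r.
have [S0|/SW2 h2] := pselect (entry S c b = 0); last by case: nW; exact: WW h1 h2.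
by rewrite -[S _ c]/(entry S c b) S0 mulr0.
Qed.

Lemma closure_banded_lin E : directed E -> forall (c : R[i]) T S,
  norm_closure (banded E) T -> norm_closure (banded E) S ->
  norm_closure (banded E) (c *: T + S).
Proof. by move=> dE; apply: norm_closure_lin; [exact: banded_bop|exact: banded_lin]. Qed.

Lemma closure_banded_comp E : comp_closed E -> forall T S,
  norm_closure (banded E) T -> norm_closure (banded E) S ->
  norm_closure (banded E) (T \o S).
Proof. by move=> cE; apply: norm_closure_comp; [exact: banded_bop|exact: banded_comp]. Qed.

Lemma sub_lin_span (A V : set op) :
  V 0 -> (forall (c : R[i]) T S, V T -> V S -> V (c *: T + S)) ->
  A `<=` V -> lin_span A `<=` V.
Proof.
move=> V0 Vlin AV T [n [c [S [AS ->]]]]; elim/big_rec: _ => // k U _ VU.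
by apply: Vlin => //; exact/AV.
Qed.

Lemma lin_span_sub (A : set op) : A `<=` lin_span A.
Proof.
move=> T AT; exists 1, (fun=> 1), (fun=> T); split=> //.
by rewrite big_ord1 scale1r.
Qed.

Lemma lin_spanD (A : set op) T S : lin_span A T -> lin_span A S -> lin_span A (T + S).
Proof.
move=> [n [c [F [AF ->]]]] [m [d [G [AG ->]]]].
exists (n + m)%N, (fun k => match fintype.split k with inl i => c i | inr j => d j end),
  (fun k => match fintype.split k with inl i => F i | inr j => G j end); split.
  by move=> k; case: fintype.split.
rewrite big_split_ord; congr (_ + _); apply: eq_bigr => k _.
  by rewrite (unsplitK (inl k)).
by rewrite (unsplitK (inr k)).
Qed.

Lemma lin_span_sum (A : set op) n (F : nat -> op) : (0 < n)%N ->
  (forall k, (k < n)%N -> lin_span A (F k)) -> lin_span A (\sum_(k < n) F k).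
Proof.
elim: n => // n ih _ AF; rewrite big_ord_recr/=.
have [->|n0] := posnP n; first by rewrite big_ord0 add0r; exact: AF.
by apply: lin_spanD; [apply: ih => // k kn; apply: AF; exact: ltnW|exact: AF].
Qed.

Lemma lin_span_bop (A : set op) : A `<=` bop -> lin_span A `<=` bop.
Proof.
by move=> bA; apply: sub_lin_span => // [|c T S]; [exact: bop_zero|exact: bop_lin].
Qed.

End banded_operators.

(** * Blocks of an operator on l^p(I x J), and tensor algebras as closures of banded operators *)

Section tensor_algebra_banded.
Context {R : realType} {p : R} {p1 : 1 <= p} {I J : choiceType}.
Local Notation opI := (lp I p1 -> lp I p1).
Local Notation opJ := (lp J p1 -> lp J p1).
Local Notation opIJ := (lp (I * J)%type p1 -> lp (I * J)%type p1).

(** The (i, j) block of [T], seen as a matrix over [J] whose entries are operators on l^p(I).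
    [block] puts it back in its place and is zero elsewhere. *)
Definition corner (i j : J) (T : opIJ) : opI := slice i \o T \o emb j.

Definition block (i j : J) (T : opIJ) : opIJ := emb i \o corner i j T \o slice j.

Lemma bop_corner i j (T : opIJ) : bop T -> bop (corner i j T).
Proof.
move=> bT; have [M M0 MT] := bopP bT.
apply: (@bop_of_bound _ _ _ _ _ M) => [c xi eta|].
  by rewrite /corner/= emb_linear (bop_linear bT) slice_linear.
split=> xi; apply: le_trans (slice_norm _ _) _; apply: le_trans (MT _) _.
by rewrite emb_norm.
Qed.

Lemma bop_block i j (T : opIJ) : bop T -> bop (block i j T).
Proof.
move=> bT; have [M M0 MT] := bopP (bop_corner i j bT).
apply: (@bop_of_bound _ _ _ _ _ M) => [c xi eta|].
  by rewrite /block/= slice_linear (bop_linear (bop_corner i j bT)) emb_linear.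
split=> xi; rewrite emb_norm; apply: le_trans (MT _) _.
by rewrite ler_wpM2l// slice_norm.
Qed.

Lemma entry_corner i j (T : opIJ) (x y : I) :
  entry (corner i j T) x y = entry T (x, i) (y, j).
Proof. by rewrite /entry /corner/= sliceE emb_delta. Qed.

(** A block is T_ij (x) e_ij, since the j-th slice of xi (x) eta is the multiple [eta j] of [xi].
    This makes blocks elementary tensors. *)
Lemma block_is_tensor_op i j (T : opIJ) : bop T ->
  is_tensor_op (corner i j T) (munit i j) (block i j T).
Proof.
move=> bT; split; first by apply: bop_bounded; exact: bop_block.
move=> xi eta; apply: lp_ext => z.
rewrite /block -[LHS]/(emb i (corner i j T (slice j _)) z) slice_tensor.
rewrite (bopZ (bop_corner i j bT)) embE tensor_vecE lp_scaleE.
by rewrite -[munit _ _ _ _]/(eta j * (z.2 == i)%:R) mulrCA mulrA.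
Qed.

Lemma entry_block i j (T : opIJ) (x y : I * J) : bop T -> entry (block i j T) x y =
  entry T (x.1, i) (y.1, j) * ((x.2 == i) && (y.2 == j))%:R.
Proof.
move=> bT; rewrite (entry_is_tensor_op _ _ (block_is_tensor_op i j bT)).
by rewrite entry_corner entry_munit.
Qed.

End tensor_algebra_banded.

Section tensor_alg_banded.
Context {R : realType} {p : R} {p1 : 1 <= p} {I : choiceType}.
Local Notation opI := (lp I p1 -> lp I p1).
Local Notation opN := (lp nat p1 -> lp nat p1).
Local Notation opIN := (lp (I * nat)%type p1 -> lp (I * nat)%type p1).

Lemma sum_blocks n (T : opIN) : bop T ->
  supported (fun x y => (x.2 < n)%N /\ (y.2 < n)%N) T ->
  T = \sum_(i < n) \sum_(j < n) block (i : nat) (j : nat) T.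
Proof.
move=> bT Tn; apply: bop_ext => // [|[x k] [y l]].
  by do 2!(apply: bop_bigsum => ?); exact: bop_block.
have entry_sum (m : nat) (F : 'I_m -> opIN) a b :
    entry (\sum_(i < m) F i) a b = \sum_(i < m) entry (F i) a b.
  by rewrite /entry fct_sumE lp_sumrE.
rewrite entry_sum; under eq_bigr => i _ do rewrite entry_sum.
under eq_bigr => i _ do under eq_bigr => j _ do rewrite entry_block//=.
have [T0|Tne] := pselect (entry T (x, k) (y, l) = 0).
  rewrite T0 big1// => i _; rewrite big1// => j _.
  by case: eqP => [<-|]; case: eqP => [<-|] /=; rewrite ?mulr0 ?T0 ?mul0r.
have [/= kn ln] := Tn _ _ Tne.
rewrite (bigD1 (Ordinal kn))//= (bigD1 (Ordinal ln))//= !eqxx mulr1.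
rewrite big1 ?big1 => [|i ik|j jl]; rewrite ?addr0//.
  rewrite big1// => j _; case: eqP => [ki|]; rewrite ?mulr0//.
  by case/eqP: ik; apply: val_inj; rewrite /= ki.
rewrite [l == _]eq_sym; case: eqP => [jl'|]; rewrite ?mulr0//.
by case/eqP: jl; apply: val_inj.
Qed.

(** Serves both tensor algebras. The approximation hypothesis puts every a (x) b into the closure of
    the banded operators; the decomposition hypothesis writes a banded operator as a finite sum of
    blocks, each an elementary tensor. *)
Lemma tensor_alg_banded (A : set opI) (B : set opN)
    (E : set (I * nat -> I * nat -> Prop)) :
  A `<=` bop -> B `<=` bop -> directed E ->
  (forall a b (e : R), A a -> B b -> 0 < e -> exists a' b', [/\ bop a', bop b',
     op_bound (a - a') e, op_bound (b - b') e & banded E (tens a' b')]) ->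
  (forall T, banded E T -> exists2 n, (0 < n)%N &
     supported (fun x y => (x.2 < n)%N /\ (y.2 < n)%N) T /\
     forall i j : nat, (i < n)%N -> (j < n)%N ->
       exists a b, [/\ A a, B b & is_tensor_op a b (block i j T)]) ->
  tensor_alg A B = norm_closure (banded E).
Proof.
move=> bA bB dE approx decomp; rewrite /tensor_alg.
set G := [set c | _]; have bG : G `<=` bop by move=> c [a [b [_ _ [bc _]]]].
apply/seteqP; split; last first.
  apply: norm_closure_sub; [exact: banded_bop|exact: lin_span_bop|].
  move=> T ET; apply: sub_norm_closure; first exact: lin_span_bop.
  have [bT _] := ET; have [n n0 [Tn Tab]] := decomp _ ET.
  rewrite (sum_blocks bT Tn).
  apply: (lin_span_sum (F := fun i => \sum_(j < n) block i (j : nat) T)) => // i ni.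
  apply: (lin_span_sum (F := fun j => block i j T)) => // j nj.
  by apply: lin_span_sub; have [a [b [Aa Bb ab]]] := Tab i j ni nj; exists a, b.
apply: norm_closure_sub; [exact: lin_span_bop|exact: banded_bop|].
apply: sub_lin_span.
- by apply: sub_norm_closure; [exact: banded_bop|exact: banded0].
- exact: closure_banded_lin.
move=> c [a [b [Aa Bb abc]]]; have ba := bA _ Aa; have bb := bB _ Bb.
rewrite (is_tensor_op_unique ba bb abc).
apply/(norm_closureP _ (@banded_bop _ _ _ _ _)); split=> [|e e0]; first exact: bop_tens.
have [M M0 aM] := bopP ba; have [N N0 bN] := bopP bb.
(* Since d <= 1, the approximant [a'] is bounded by 4 (M + 1); [tens_approx] then gives the error 4
   (4 (M + 1) + N) d, which is at most K d <= e. *)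
pose K := 4 * (4 * (M + 1) + N) + 1; have K0 : 0 < K by rewrite /K; lra.
pose d := Num.min 1 (e / K).
have d0 : 0 < d by rewrite lt_min ltr01 divr_gt0.
have [a' [b' [ba' bb' aa' bb_ Eab]]] := approx a b d Aa Bb d0.
exists (tens a' b') => //.
have a'M : op_bound a' (4 * (M + 1)).
  split=> xi; have -> : a' xi = a xi + - ((a - a') xi).
    by rewrite -[(a - a') xi]/(a xi - a' xi) opprB addrC subrK.
  apply: le_trans (lpn_quasiD _ _) _; rewrite -scaleN1r lpnZ normcN normc1 mul1r.
  rewrite -[leRHS]mulrA ler_pM2l// mulrDl mul1r; apply: lerD; first exact: aM.
  apply: le_trans (aa' xi) _; rewrite -[leRHS]mul1r ler_wpM2r ?lpn_ge0//.
  by rewrite ge_min lexx.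
have M40 : 0 <= 4 * (M + 1) by lra.
apply: op_bound_le (tens_approx ba bb ba' bb' M40 N0 (ltW d0) a'M bN aa' bb_).
have dK : d * K <= e by rewrite -ler_pdivlMr// ge_min lexx orbT.
rewrite /K in dK; nra.
Qed.

End tensor_alg_banded.

(** * The band families of the stabilized Roe algebra and of its Cartan subalgebra *)

Section band_families.
Context {R : realType} {p : R} {p1 : 1 <= p}.

Definition ctl {X : metricType R} (r : R) (n : nat) (a b : X * nat) : Prop :=
  [/\ mdist a.1 b.1 <= r, (a.2 < n)%N & (b.2 < n)%N].

Definition ctl_bands (X : metricType R) : set (X * nat -> X * nat -> Prop) :=
  [set W | exists r n, W = ctl r n].

Definition diag_bands (X : choiceType) : set (X * nat -> X * nat -> Prop) :=
  [set W | exists n, W = fun a b => a = b /\ (a.2 < n)%N].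

Lemma directed_ctl X : directed (@ctl_bands X).
Proof.
split=> [|_ _ [r1 [n1 ->]] [r2 [n2 ->]]]; first by exists (ctl 0 0), 0, 0%N.
exists (ctl (Num.max r1 r2) (maxn n1 n2)); first by exists (Num.max r1 r2), (maxn n1 n2).
move=> a b [] [ab an bn]; split; rewrite ?le_max ?ab ?orbT//.
- exact: leq_trans an (leq_maxl _ _).
- exact: leq_trans bn (leq_maxl _ _).
- exact: leq_trans an (leq_maxr _ _).
- exact: leq_trans bn (leq_maxr _ _).
Qed.

Lemma comp_closed_ctl X : comp_closed (@ctl_bands X).
Proof.
move=> _ _ [r1 [n1 ->]] [r2 [n2 ->]].
exists (ctl (r1 + r2) (maxn n1 n2)); first by exists (r1 + r2), (maxn n1 n2).
move=> a b c [ab an _] [bc _ cn]; split.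
- exact: le_trans (metric_triangle _ b.1 _) (lerD ab bc).
- exact: leq_trans an (leq_maxl _ _).
- exact: leq_trans cn (leq_maxr _ _).
Qed.

Lemma directed_diag X : directed (@diag_bands X).
Proof.
split=> [|_ _ [n1 ->] [n2 ->]]; first by exists (fun a b => a = b /\ (a.2 < 0)%N), 0%N.
exists (fun a b => a = b /\ (a.2 < maxn n1 n2)%N); first by exists (maxn n1 n2).
move=> a b [] [ab an]; split=> //.
- exact: leq_trans an (leq_maxl _ _).
- exact: leq_trans an (leq_maxr _ _).
Qed.

(** Subtracting from [xi] its component at [a] leaves a vector that row [a] of [T] annihilates
    termwise. *)
Lemma bop_diag {I : choiceType} (T : lp I p1 -> lp I p1) xi a : bop T ->
  supported eq T -> T xi a = entry T a a * xi a.
Proof.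
move=> bT Td; apply/eqP; rewrite -subr_eq0; apply/eqP.
have -> : T xi a - entry T a a * xi a = T (xi - xi a *: delta p1 a) a.
  by rewrite (bopB bT) (bopZ bT) lp_addE lp_oppE lp_scaleE [_ * xi a]mulrC.
apply: bop_coord_eq0 => // b; rewrite lp_addE lp_oppE lp_scaleE lp_deltaE.
have [->|ab] := eqVneq b a; first by rewrite mulr1 subrr mulr0.
have [->|/Td /esym/eqP] := pselect (entry T a b = 0); first by rewrite mul0r.
by rewrite (negbTE ab).
Qed.

Lemma matrix_opE n (A : 'M[R[i]]_n) :
  @matrix_op R p p1 n A = \sum_(i < n) \sum_(j < n) A i j *: munit (i : nat) (j : nat).
Proof.
apply/funext => xi; rewrite fct_sumE; apply: eq_bigr => i _.
rewrite fct_sumE scaler_suml; apply: eq_bigr => j _.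
by rewrite -[RHS]/(A i j *: (xi (j : nat) *: delta p1 (i : nat))) scalerA.
Qed.

Lemma bop_matrix_op n (A : 'M[R[i]]_n) : bop (@matrix_op R p p1 n A).
Proof.
rewrite matrix_opE; do 2!(apply: bop_bigsum => ?).
by apply: bop_scale; exact: bop_munit.
Qed.

Lemma entry_matrix_op n (A : 'M[R[i]]_n) (k l : nat) :
  entry (@matrix_op R p p1 n A) k l =
  \sum_(i < n) \sum_(j < n) A i j * ((k == i) && (l == j))%:R.
Proof.
rewrite /entry matrix_opE fct_sumE lp_sumrE; apply: eq_bigr => i _.
rewrite fct_sumE lp_sumrE; apply: eq_bigr => j _.
by rewrite -(entry_munit (p1 := p1)).
Qed.

Lemma entry_matrix_ord n (A : 'M[R[i]]_n) (i j : 'I_n) :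
  entry (@matrix_op R p p1 n A) i j = A i j.
Proof.
rewrite entry_matrix_op (bigD1 i)//= (bigD1 j)//= !eqxx mulr1.
rewrite big1 ?big1 => [|k ki|k kj]; rewrite ?addr0//.
  rewrite big1// => l _; case: eqP => [ik|]; rewrite ?mulr0//.
  by case/eqP: ki; apply: val_inj.
rewrite eq_sym; case: eqP => [jk|]; rewrite ?mulr0//.
by case/eqP: kj; apply: val_inj.
Qed.

Lemma supported_matrix_op n (A : 'M[R[i]]_n) :
  supported (fun k l : nat => (k < n)%N /\ (l < n)%N) (@matrix_op R p p1 n A).
Proof.
move=> k l; rewrite entry_matrix_op => h; apply: contrapT => kl; apply: h.
rewrite big1// => i _; rewrite big1// => j _.
case: eqP => [ki|]; case: eqP => [lj|]; rewrite ?mulr0//.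
by case: kl; rewrite ki lj.
Qed.

Lemma munit_matrix_op (i j : nat) : exists n (A : 'M[R[i]]_n),
  @munit R p p1 nat i j = matrix_op A.
Proof.
have ni : (i < (maxn i j).+1)%N by rewrite ltnS leq_maxl.
have nj : (j < (maxn i j).+1)%N by rewrite ltnS leq_maxr.
exists (maxn i j).+1, (delta_mx (Ordinal ni) (Ordinal nj)).
apply: bop_ext => [||k l]; [exact: bop_munit|exact: bop_matrix_op|].
rewrite entry_munit entry_matrix_op (bigD1 (Ordinal ni))//= (bigD1 (Ordinal nj))//=.
rewrite mxE !eqxx mul1r big1 ?big1 => [|k' /negbTE h|l' /negbTE h]; rewrite ?addr0//.
  by rewrite big1// => l' _; rewrite mxE h mul0r.
by rewrite mxE h andbF mul0r.
Qed.

Lemma sub_matrix_op_bop : [set T | exists n (A : 'M[R[i]]_n), T = @matrix_op R p p1 n A] `<=` bop.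
Proof. by move=> _ [n [A ->]]; exact: bop_matrix_op. Qed.

Lemma Minfty_munit (i j : nat) : Minfty p1 (munit i j).
Proof.
by apply: sub_norm_closure; [exact: sub_matrix_op_bop|exact: munit_matrix_op].
Qed.

Lemma Minfty_approx b (e : R) : Minfty p1 b -> 0 < e -> exists b' n,
  [/\ bop b', op_bound (b - b') e & supported (fun k l => (k < n)%N /\ (l < n)%N) b'].
Proof.
move=> /(norm_closureP _ sub_matrix_op_bop)[bb bA] e0.
have [_ [n [A ->]] bAe] := bA _ e0; exists (matrix_op A), n.
by split=> //; [exact: bop_matrix_op|exact: supported_matrix_op].
Qed.

Section uniform_Roe_theory.
Context (X : metricType R).

Lemma propagation_lty (T : lp X p1 -> lp X p1) :
  (propagation T < +oo)%E <-> exists r : R, supported (fun x y => mdist x y <= r) T.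
Proof.
split=> [Tlt|[r Tr]]; last first.
  apply: (@le_lt_trans _ _ r%:E); last exact: ltry.
  by apply: ge_ereal_sup => _ [[x y] /= /eqP Txy <-]; rewrite lee_fin; exact: Tr.
(* A nonzero entry bounds the supremum from below, so that it is finite and [fine] returns it;
   without nonzero entries any radius will do. *)
exists (fine (propagation T)) => x y /eqP Txy.
have ub : ((mdist x y)%:E <= propagation T)%E.
  by apply: ereal_sup_ubound; exists (x, y).
have : propagation T \is a fin_num.
  by rewrite fin_numE -ltey Tlt andbT gt_eqF// (lt_le_trans _ ub)// ltNyr.
by move=> Tfin; rewrite -lee_fin fineK.
Qed.

Lemma sub_propagation_bop :
  [set T | bounded_op T /\ (propagation T < +oo)%E] `<=` @bop R p p1 X.
Proof. by move=> T [bT _]; split. Qed.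

Lemma uniform_Roe_approx a (e : R) : uniform_Roe p1 X a -> 0 < e -> exists a' r,
  [/\ bop a', op_bound (a - a') e & supported (fun x y => mdist x y <= r) a'].
Proof.
move=> /(norm_closureP _ sub_propagation_bop)[ba aA] e0.
have [a' [ba' /propagation_lty[r ar]] aae] := aA _ e0.
by exists a', r; split=> //; split.
Qed.

Lemma uniform_Roe_supported a (r : R) : bop a ->
  supported (fun x y => mdist x y <= r) a -> uniform_Roe p1 X a.
Proof.
move=> ba ar; apply: sub_norm_closure; first exact: sub_propagation_bop.
by split; [exact: bop_bounded|apply/propagation_lty; exists r].
Qed.

Lemma supported_tens (a : lp X p1 -> lp X p1) (b : lp nat p1 -> lp nat p1)
    (W : X -> X -> Prop) (V : nat -> nat -> Prop) : bop a -> bop b ->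
  supported W a -> supported V b ->
  supported (fun x y => W x.1 y.1 /\ V x.2 y.2) (tens a b).
Proof.
move=> ba bb aW bV x y; rewrite (entry_is_tensor_op _ _ (tensP ba bb)) => /eqP.
by rewrite mulf_eq0 negb_or => /andP[/eqP/aW h1 /eqP/bV h2].
Qed.

(** Approximating the factors by an operator of finite propagation and by a finite matrix puts their
    tensor product in a band. Conversely, each block of a banded operator has finite propagation. *)
Lemma stable_RoeE : stable_Roe p1 X = norm_closure (banded (@ctl_bands X)).
Proof.
apply: tensor_alg_banded.
- exact: norm_closure_bounded.
- exact: norm_closure_bounded.
- exact: directed_ctl.
- move=> a b e aX bM e0.
  have [a' [r [ba' aa' ar]]] := uniform_Roe_approx aX e0.
  have [b' [n [bb' bb bn]]] := Minfty_approx bM e0.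
  exists a', b'; split=> //; split; first exact: bop_tens.
  exists (ctl r n); first by exists r, n.
  by move=> x y /(supported_tens ba' bb' ar bn)[? []].
(* The successor makes the number of levels positive, as [tensor_alg_banded] demands. *)
- move=> T [bT [_ [r [n ->]] Tr]]; exists n.+1 => //; split.
    by move=> x y /Tr[_ xn yn]; split; apply: ltnW.
  move=> i j _ _; exists (corner i j T), (munit i j); split.
  + apply: (@uniform_Roe_supported _ r); first exact: bop_corner.
    by move=> x y; rewrite entry_corner => /Tr[].
  + exact: Minfty_munit.
  + exact: block_is_tensor_op.
Qed.

End uniform_Roe_theory.

Lemma c0_tail (g : nat -> R[i]) (e : R) : c0 g -> 0 < e ->
  exists n, forall k, (n <= k)%N -> normc (g k) <= e.
Proof.
move=> /cvgrPdist_le/(_ e) h /h[n _ hn]; exists n => k nk.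
by have := hn k nk; rewrite /= sub0r normrN ger0_norm// normc_ge0.
Qed.

Lemma sub_linfty_bop (X : choiceType) : mult_ops p1 (linfty X) `<=` bop.
Proof.
move=> T [f [M fM] Tf]; apply: (mulop_bop (M := `|M|) (f := f)) => // i.
exact: le_trans (fM i) (ler_norm _).
Qed.

Lemma sub_c0_bop : mult_ops p1 c0 `<=` bop.
Proof.
move=> T [f fc Tf].
have [n hn] := c0_tail fc ltr01.
(* From [n] on the values are at most 1; each earlier one is bounded by the sum. *)
pose M := \sum_(i < n) normc (f i) + 1.
have M0 : 0 <= M by rewrite addr_ge0// sumr_ge0// => i _; exact: normc_ge0.
apply: (mulop_bop (M := M) (f := f)) => // k.
have [nk|kn] := leqP n k.
  apply: le_trans (hn k nk) _; rewrite lerDr sumr_ge0// => i _; exact: normc_ge0.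
rewrite /M (bigD1 (Ordinal kn))//= -addrA lerDl addr_ge0// sumr_ge0// => i _.
exact: normc_ge0.
Qed.

Lemma mult_ops_diag {I : choiceType} (F : set (I -> R[i])) T :
  mult_ops p1 F T -> supported eq T.
Proof.
move=> [f _ Tf] a b; rewrite /entry Tf lp_deltaE.
by case: eqP => // _; rewrite mulr0.
Qed.

(** Truncates the multiplier after finitely many terms; the error is a multiplication operator
    bounded by the tail. *)
Lemma c0_approx b (e : R) : mult_ops p1 c0 b -> 0 < e -> exists b' n,
  [/\ bop b', op_bound (b - b') e & supported (fun k l => k = l /\ (k < n)%N) b'].
Proof.
move=> [g gc bg] e0; have [n hn] := c0_tail gc e0.
pose b' : lp nat p1 -> lp nat p1 := \sum_(k < n) g k *: munit (k : nat) (k : nat).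
have b'E xi k : b' xi k = (k < n)%:R * (g k * xi k).
  rewrite /b' fct_sumE lp_sumrE.
  have term (i : nat) : (g i *: munit i i) xi k = (k == i)%:R * (g i * xi i).
    rewrite -[LHS]/(g i * (xi i * (k == i)%:R)).
    by rewrite mulrA mulrC.
  under eq_bigr => i _ do rewrite term.
  have [kn|nk] := ltnP k n.
    rewrite (bigD1 (Ordinal kn))//= eqxx big1 ?addr0// => i ik.
    by case: eqP => [ki|]; rewrite ?mul0r//; case/eqP: ik; apply: val_inj.
  rewrite big1 ?mul0r// => i _; case: eqP => [ki|]; rewrite ?mul0r//.
  by move: (ltn_ord i); rewrite -ki ltnNge nk.
exists b', n; split.
- by apply: bop_bigsum => k; apply: bop_scale; exact: bop_munit.
- split=> xi; apply: lpn_dominated => [|k]; first exact: ltW.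
  rewrite -[X in normc X]/(b xi k - b' xi k) bg b'E.
  have [kn|nk] := ltnP k n; first by rewrite mul1r subrr normc0 mulr_ge0 ?normc_ge0// ltW.
  by rewrite mul0r subr0 normcM ler_wpM2r ?normc_ge0// hn.
- move=> k l; rewrite /entry b'E lp_deltaE.
  by case: eqP => [->|]; rewrite ?mulr0//; case: ltnP; rewrite ?mul0r.
Qed.

Lemma c0_munit (k : nat) : mult_ops p1 c0 (munit k k).
Proof.
exists (fun l => (l == k)%:R); last first.
  move=> xi l; rewrite -[LHS]/(xi k * (l == k)%:R).
  by case: eqP => [->|_]; rewrite ?mulr1 ?mul1r ?mulr0 ?mul0r.
apply: cvg_near_cst; exists k.+1 => // l /= kl.
by rewrite gtn_eqF// normc0.
Qed.

Lemma mult_ops0 {I : choiceType} (F : set (I -> R[i])) : F (fun=> 0) -> mult_ops p1 F 0.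
Proof. by move=> F0; exists (fun=> 0) => // xi i; rewrite mul0r. Qed.

Lemma stable_CartanE (X : metricType R) :
  stable_Cartan p1 X = norm_closure (banded (@diag_bands X)).
Proof.
apply: tensor_alg_banded.
- exact: sub_linfty_bop.
- exact: sub_c0_bop.
- exact: directed_diag.
- move=> a b e aX bM e0; have ba := sub_linfty_bop aX.
  have [b' [n [bb' bb bn]]] := c0_approx bM e0.
  exists a, b'; split=> //.
    split=> xi; rewrite -[X in lpn X]/(a xi - a xi) subrr lpn0.
    by rewrite mulr_ge0 ?lpn_ge0// ltW.
  split; first exact: bop_tens.
  exists (fun x y => x = y /\ (x.2 < n)%N); first by exists n.
  move=> [x k] [y l] /(supported_tens ba bb' (mult_ops_diag aX) bn)/= [-> [-> ln]].
  by [].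
- move=> T [bT [_ [n ->] Tr]]; exists n.+1 => //; split.
    by move=> x y /Tr[<- xn]; split; apply: ltnW.
  (* A diagonal block is a bounded multiplication operator tensored with e_ii. An off-diagonal block
     vanishes and is written as 0 (x) 0. *)
  move=> i j _ _; have [<-|ij] := eqVneq i j.
    exists (corner i i T), (munit i i); split.
    + exists (fun x => entry T (x, i) (x, i)).
        by exists (opn T) => x; exact: entry_le_opn.
      move=> xi x; rewrite -entry_corner; apply: bop_diag; first exact: bop_corner.
      by move=> y z; rewrite entry_corner => /Tr[[]].
    + exact: c0_munit.
    + exact: block_is_tensor_op.
  exists 0, 0; split.
  + by apply: mult_ops0; exists 0 => x; rewrite normc0.
  + by apply: mult_ops0; apply: cvg_near_cst; exists 0%N => // k _; rewrite normc0.
  + have -> : block i j T = 0.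
      apply: bop_ext => [||x y]; [exact: bop_block|exact: bop_zero|].
      rewrite entry_block// -[RHS]/(0 : R[i]).
      have [->|/Tr[[_ ij']]] := pselect (entry T (x.1, i) (y.1, j) = 0); first by rewrite mul0r.
      by rewrite ij' eqxx in ij.
    split; first by apply: bop_bounded; exact: bop_zero.
    move=> xi eta; apply: lp_ext => z.
    by rewrite tensor_vecE -[LHS]/(0 : R[i]) -[(0 : lp X p1 -> lp X p1) xi _]/(0 : R[i]) mul0r.
Qed.

End band_families.

(** * The indicator operator of a band *)

Section band_indicator.
Context {R : realType} {p : R} {p1 : 1 <= p}.

Lemma normc_sum (A : Type) (s : seq A) (f : A -> R[i]) :
  normc (\sum_(x <- s) f x) <= \sum_(x <- s) normc (f x).
Proof.
elim: s => [|x s ih]; first by rewrite !big_nil normc0.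
by rewrite !big_cons (le_trans (le_normcD _ _))// lerD2l.
Qed.

(** A crude form of Hölder's inequality: each term is at most the p-th root of the sum of the p-th
    powers, and there are at most [N] terms. *)
Lemma sum_powR_le (A : eqType) (s : seq A) (f : A -> R) (N : nat) :
  (forall x, 0 <= f x) -> (size s <= N)%N ->
  (\sum_(x <- s) f x) `^ p <= N%:R `^ p * \sum_(x <- s) f x `^ p.
Proof.
move=> f0 sN; set S := \sum_(x <- s) f x `^ p.
have S0 : 0 <= S by apply: sumr_ge0 => x _; exact: powR_ge0.
have fS x : x \in s -> f x <= S `^ p^-1.
  move=> xs; rewrite -(powR_p_le p1) ?powR_ge0// powR_invVK// /S.
  by rewrite (big_rem x)//= lerDl sumr_ge0// => y _; exact: powR_ge0.
have sumS : \sum_(x <- s) f x <= N%:R * S `^ p^-1.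
  apply: (@le_trans _ _ (\sum_(x <- s) S `^ p^-1)).
    by rewrite big_seq [leRHS]big_seq; apply: ler_sum.
  rewrite big_const_seq count_predT iter_addr_0 -[leLHS]mulr_natl.
  by rewrite ler_wpM2r ?powR_ge0// ler_nat.
rewrite -[S](powR_invVK p1)// -powRM ?ler0n ?powR_ge0//.
by rewrite powR_p_le// ?mulr_ge0 ?ler0n ?powR_ge0// sumr_ge0.
Qed.

Context {X : metricType R} (hX : bounded_geometry X).

Lemma exchange_esum (I J : choiceType) (F : I -> J -> \bar R) :
  (forall i j, (0 <= F i j)%E) ->
  (\esum_(i in [set: I]) \esum_(j in [set: J]) F i j =
   \esum_(j in [set: J]) \esum_(i in [set: I]) F i j)%E.
Proof.
move=> F0; rewrite !(esum_esum (fun=> _))//.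
rewrite (@reindex_esum _ _ _ ([set: J] `*`` (fun=> [set: I]))
  ([set: I] `*`` (fun=> [set: J])) swap)//.
by split=> // [[a b] [c d] _ _ [-> ->]//|[a b] _]; exists (b, a).
Qed.

Definition ball_seq (r : R) (x : X) : seq X :=
  finmap.enum_fset (fset_set [set y | mdist x y <= r]).

Lemma ball_seqP (r : R) : 0 <= r -> exists N : nat, forall x,
  [/\ uniq (ball_seq r x), (size (ball_seq r x) <= N)%N &
      forall y, (y \in ball_seq r x) = (mdist x y <= r)].
Proof.
move=> r0; have [N hN] := hX r0; exists N => x; split.
- exact: finmap.fset_uniq.
- exact: geq_card_fset_set.
- move=> y; have fin : finite_set [set y | mdist x y <= r].
    by apply/finite_set_leP; exists N.
  transitivity (y \in [set y | mdist x y <= r]); first by rewrite -(in_fset_set fin).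
  by apply/idP/idP; rewrite inE.
Qed.

Lemma ball_indicator (r : R) : 0 <= r -> exists t : lp X p1 -> lp X p1,
  bop t /\ forall x y, entry t x y = (mdist x y <= r)%R%:R.
Proof.
move=> r0; have [N hN] := ball_seqP r0.
pose f (xi : lp X p1) (x : X) : R[i] := \sum_(y <- ball_seq r x) xi y.
pose F (xi : lp X p1) (x y : X) : R := if mdist x y <= r then normc (xi y) `^ p else 0.
have F0 xi x y : 0 <= F xi x y by rewrite /F; case: ifP; rewrite ?powR_ge0.
have sumF (g : X -> R) x : (forall y, 0 <= g y) ->
    (\sum_(y <- ball_seq r x) g y)%:E =
    (\esum_(y in [set: X]) (if mdist x y <= r then g y else 0)%:E)%E.
  move=> g0; have [_ _ bE] := hN x.
  have fin : finite_set [set y | mdist x y <= r].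
    by have [M hM] := hX r0; apply/finite_set_leP; exists M.
  rewrite [RHS](_ : _ = (\esum_(y in [set y | (mdist x y <= r)%R]) (g y)%:E)%E); last first.
    rewrite [RHS]esum_mkcond; apply: eq_esum => y _.
    have -> : (y \in [set y | mdist x y <= r]) = (mdist x y <= r).
      by apply/idP/idP; rewrite inE.
    by case: ifP.
  by rewrite esum_fset ?fsbig_finite ?sumEFin//= => y _; rewrite lee_fin.
(* [sum_powR_le] gives N^p on each row. After the sums are exchanged, each |xi y|^p is counted once
   for every point of the ball around [y], hence at most N times, and N <= N^p. *)
have fle xi : (lp_sum p (f xi) <= ((N%:R * N%:R) `^ p)%:E * lp_sum p xi)%E.
  apply: (@le_trans _ _ (\esum_(x in [set: X]) ((N%:R `^ p)%:E *
     \esum_(y in [set: X]) (F xi x y)%:E))%E).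
    apply: le_esum => x _.
    rewrite /F -sumF => [|y]; last exact: powR_ge0.
    have [_ sN _] := hN x.
    rewrite -EFinM lee_fin; apply: le_trans (sum_powR_le _ sN); last by move=> y; exact: normc_ge0.
    rewrite powR_p_le ?normc_ge0//; last by apply: sumr_ge0 => y _; exact: normc_ge0.
    exact: normc_sum.
  have mulE (g : X -> \bar R) (c : R) : 0 <= c -> (forall x, 0 <= g x)%E ->
      (\esum_(x in [set: X]) (c%:E * g x) <= c%:E * \esum_(x in [set: X]) g x)%E.
    move=> c0 g0; apply: ge_ereal_sup => _ [A AI <-].
    rewrite -ge0_mule_fsumr//; apply: lee_wpmul2l; first by rewrite lee_fin.
    by apply: ereal_sup_ubound; exists A.
  apply: le_trans (mulE _ _ (powR_ge0 _ _) _) _.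
    by move=> x; apply: esum_ge0 => y _; rewrite lee_fin.
  rewrite powRM ?ler0n// EFinM -muleA.
  apply: lee_wpmul2l; first by rewrite lee_fin powR_ge0.
  rewrite exchange_esum => [|x y]; last by rewrite lee_fin.
  apply: (@le_trans _ _ (\esum_(y in [set: X]) (N%:R%:E * (normc (xi y) `^ p)%:E))%E).
    apply: le_esum => y _.
    have -> : (\esum_(x in [set: X]) (F xi x y)%:E =
        (\sum_(x <- ball_seq r y) normc (xi y) `^ p)%:E)%E.
      rewrite sumF => [|x]; last exact: powR_ge0.
      by apply: eq_esum => x _; rewrite /F metric_sym.
    rewrite -EFinM lee_fin big_const_seq count_predT iter_addr_0 -[leLHS]mulr_natl.
    by rewrite ler_wpM2r ?powR_ge0// ler_nat; have [] := hN y.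
  apply: le_trans (mulE _ _ (ler0n _ _) _) _.
    by move=> x; rewrite lee_fin powR_ge0.
  apply: lee_wpmul2r; first exact: lp_sum_ge0.
  (* N <= N^p holds by monotonicity in the exponent when N >= 1, so that N = 0 is treated apart. *)
  rewrite lee_fin; case: N {hN mulE} => [|N]; first exact: powR_ge0.
  by rewrite -[leLHS]powRr1 ?ler0n// ler_powR// ler1n.
have fE xi x : (mklp (f xi) : lp X p1) x = f xi x.
  by rewrite mklpE// (le_lt_trans (fle xi))// lp_sumE -EFinM ltry.
exists (fun xi => mklp (f xi)); split; last first.
  move=> x y; rewrite /entry fE /f; have [u _ bE] := hN x.
  rewrite -bE; case: (boolP (y \in _)) => [yb|nyb].
    rewrite (bigD1_seq y)// big1 => [|z zy]; last by rewrite lp_deltaE (negbTE zy).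
    by rewrite lp_deltaE eqxx; exact: addr0.
  rewrite big_seq big1// => z zb; rewrite lp_deltaE.
  by case: eqP => // zy; move: nyb; rewrite -zy zb.
apply: (@bop_of_bound _ _ _ _ _ (N%:R * N%:R)) => [c xi eta|].
  apply: lp_ext => x; rewrite -[RHS]/(c * lp_val (mklp (f xi)) x + lp_val (mklp (f eta)) x).
  rewrite !fE /f mulr_sumr -big_split/=; apply: eq_bigr => y _.
  by [].
split=> xi; apply: lpn_le; first by rewrite mulr_ge0 ?ler0n.
rewrite [X in lp_sum p X](_ : _ = f xi); first exact: fle.
by apply/funext => x; rewrite fE.
Qed.

Lemma stable_Roe_munit (a b : X * nat) : stable_Roe p1 X (munit a b).
Proof.
rewrite stable_RoeE; apply: sub_norm_closure; first exact: banded_bop.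
split; first exact: bop_munit.
exists (ctl (mdist a.1 b.1) (maxn a.2 b.2).+1); first by do 2!eexists.
move=> x y; rewrite entry_munit; case: eqP => [->|//]; case: eqP => [->|//] _.
by split; rewrite ?ltnS ?leq_maxl ?leq_maxr.
Qed.

(** The tensor product of the indicator matrix of the radius-[r] neighbourhood of the diagonal with
    the all-ones matrix of size [n]. *)
Lemma ctl_indicator (r : R) (n : nat) : 0 <= r -> exists2 T,
  stable_Roe p1 X T & forall a b, ctl r n a b -> entry T a b = 1.
Proof.
move=> r0; have [t [bt tE]] := ball_indicator r0.
pose u : lp nat p1 -> lp nat p1 := matrix_op (const_mx 1 : 'M[R[i]]_n).
have bu : bop u by exact: bop_matrix_op.
exists (tens t u); last first.
  move=> [x k] [y l] [/= xy kn ln].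
  rewrite (entry_is_tensor_op _ _ (tensP bt bu))/= tE xy mul1r.
  by rewrite (entry_matrix_ord (p1 := p1) _ (Ordinal kn) (Ordinal ln)) mxE.
rewrite stable_RoeE; apply: sub_norm_closure; first exact: banded_bop.
split; first exact: bop_tens.
exists (ctl r n); first by exists r, n.
have tr : supported (fun x y => mdist x y <= r) t.
  by move=> x y; rewrite tE; case: (mdist x y <= r).
by move=> x y /(supported_tens bt bu tr (supported_matrix_op (A := _)))[? []].
Qed.

End band_indicator.

(** * Isomorphisms preserving diagonal matrix units *)

Definition controlled {R : realType} {X Y : metricType R} (F : X * nat -> Y * nat) :=
  forall (r : R) n, exists r' n', forall a b, ctl r n a b -> ctl r' n' (F a) (F b).

Definition stably_equivalent {R : realType} (X Y : metricType R) :=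
  exists (F : X * nat -> Y * nat) (G : Y * nat -> X * nat),
    [/\ cancel F G, cancel G F, controlled F & controlled G].

Section iso_inverse.
Context {R : realType} {p : R} {p1 : 1 <= p} {I J : choiceType}.
Context (A : set (lp I p1 -> lp I p1)) (B : set (lp J p1 -> lp J p1)).

Lemma iso_inverse phi : isometric_iso A B phi ->
  (forall c a b, A a -> A b -> A (c *: a + b)) ->
  (forall a b, A a -> A b -> A (a \o b)) ->
  exists psi, [/\ isometric_iso B A psi, {in A, cancel phi psi} & {in B, cancel psi phi}].
Proof.
move=> [[funphi injphi surphi] linphi mulphi isophi] Alin Acomp.
(* An element outside [B] has no preimage in [A], and there [psi] takes the default value 0. *)
pose psi b := xget (0 : lp I p1 -> lp I p1) [set a | A a /\ phi a = b].
have psiP b : B b -> A (psi b) /\ phi (psi b) = b.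
  by move=> Bb; rewrite /psi; case: xgetP => [a _ //|]; have [a Aa <-] := surphi b Bb => /(_ a)[].
have phiA a : A a -> B (phi a) by move=> Aa; exact: funphi.
have inj a a' : A a -> A a' -> phi a = phi a' -> a = a'.
  by move=> Aa Aa'; apply: injphi; rewrite inE.
have phiK a : A a -> psi (phi a) = a.
  by move=> Aa; have [Apsi E] := psiP _ (phiA _ Aa); exact: inj E.
exists psi; split; [|by move=> a; rewrite inE; exact: phiK|by move=> b; rewrite inE => /psiP[]].
split.
- split=> [b Bb|b b'|a Aa]; first by have [] := psiP b Bb.
    rewrite !inE => Bb Bb' E; have [_ <-] := psiP b Bb; have [_ <-] := psiP b' Bb'.
    by rewrite E.
  by exists (phi a); [exact: phiA|exact: phiK].
- move=> c a b Ba Bb; have [Aa aE] := psiP a Ba; have [Ab bE] := psiP b Bb.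
  by rewrite -{1}aE -{1}bE -linphi// phiK//; exact: Alin.
- move=> a b Ba Bb; have [Aa aE] := psiP a Ba; have [Ab bE] := psiP b Bb.
  by rewrite -{1}aE -{1}bE -mulphi// phiK//; exact: Acomp.
- by move=> b Bb; have [Ab bE] := psiP b Bb; rewrite -{2}bE isophi.
Qed.

End iso_inverse.

(** * Isometric isomorphisms and matrix entries *)

Section rigidity.
Context {R : realType} {p : R} {p1 : 1 <= p}.

Section stable_Roe_algebra.
Context {X : metricType R}.
Implicit Types T S : lp (X * nat)%type p1 -> lp (X * nat)%type p1.

Lemma stable_Roe_bop : stable_Roe p1 X `<=` bop.
Proof. by rewrite stable_RoeE; exact: norm_closure_bounded. Qed.

Lemma stable_Roe_lin (c : R[i]) T S :
  stable_Roe p1 X T -> stable_Roe p1 X S -> stable_Roe p1 X (c *: T + S).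
Proof. by rewrite stable_RoeE; apply: closure_banded_lin; exact: directed_ctl. Qed.

Lemma stable_Roe_comp T S :
  stable_Roe p1 X T -> stable_Roe p1 X S -> stable_Roe p1 X (T \o S).
Proof. by rewrite stable_RoeE; apply: closure_banded_comp; exact: comp_closed_ctl. Qed.

Lemma stable_Roe0 : stable_Roe p1 X 0.
Proof.
rewrite stable_RoeE; apply: sub_norm_closure; first exact: banded_bop.
by apply: banded0; exact: directed_ctl.
Qed.

(** A banded operator within 1/2 of [T] cannot vanish at an entry where [T] has modulus at least 1,
    so its band contains all such positions. *)
Lemma stable_Roe_large_entries T : stable_Roe p1 X T ->
  exists r n, forall a b, 1 <= normc (entry T a b) -> ctl r n a b.
Proof.
rewrite stable_RoeE => /(norm_closureP _ (@banded_bop _ _ _ _ _))[bT TA].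
have h0 : 0 < 2^-1 :> R by rewrite invr_gt0.
have [S [bS [_ [r [n ->]] SW]] TS] := TA _ h0.
exists r, n => a b Tab; apply: SW => Sab.
have : normc (entry (T - S) a b) <= 2^-1.
  apply: le_trans (entry_le_opn a b (bop_sub bT bS)) _.
  by apply: opn_le => //; exact: ltW.
rewrite -[entry (T - S) a b]/(entry T a b - entry S a b) Sab subr0.
move/(le_trans Tab); rewrite leNgt => /negP; apply.
by rewrite invf_lt1// ltr1n.
Qed.

End stable_Roe_algebra.

(** These are the multiplications by indicator functions of subsets of [I]. *)
Definition diag_idempotent {I : choiceType} (e : lp I p1 -> lp I p1) :=
  [/\ bop e, supported eq e & e \o e = e].

Section matrix_units.
Context {I : choiceType}.
Implicit Types T e : lp I p1 -> lp I p1.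

Lemma munit_neq0 (a b : I) : @munit R p p1 I a b <> 0.
Proof.
move=> /(congr1 (fun T => entry T a b)); rewrite entry_munit !eqxx => /eqP.
by rewrite -[entry 0 a b]/(0 : R[i]) oner_eq0.
Qed.

Lemma munit_inj (a b : I) : @munit R p p1 I a a = munit b b -> a = b.
Proof.
move=> /(congr1 (fun T => entry T a a)); rewrite !entry_munit !eqxx.
by case: (a =P b) => // _ /eqP; rewrite oner_eq0.
Qed.

(** Together with [opn_scale_munit], this expresses the modulus of an entry by products and the norm
    alone, which an isometric isomorphism preserves. *)
Lemma munit_sandwich T (a b : I) : bop T ->
  munit a a \o (T \o munit b b) = entry T a b *: munit a b.
Proof.
move=> bT; apply/funext => xi.
rewrite -[LHS]/(T (xi b *: delta p1 b) a *: delta p1 a) (bopZ bT).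
by rewrite -[RHS]/(entry T a b *: (xi b *: delta p1 a)) scalerA mulrC.
Qed.

Lemma opn_scale_munit (c : R[i]) (a b : I) : opn (c *: @munit R p p1 I a b) = normc c.
Proof.
have bc := bop_scale c (bop_munit (p1 := p1) a b).
apply/eqP; rewrite eq_le; apply/andP; split.
  apply: opn_le; first exact: normc_ge0.
  split=> xi; rewrite -[X in lpn X]/(c *: munit a b xi) lpnZ.
  by rewrite ler_wpM2l ?normc_ge0// (le_trans (op_bound_munit _ _ _))// mul1r.
have := entry_le_opn a b bc.
by rewrite -[entry _ _ _]/(c * entry (munit a b) a b) entry_munit !eqxx mulr1.
Qed.

Lemma diag_idempotent_entry e a : diag_idempotent e -> entry e a a <> 0 -> entry e a a = 1.
Proof.
move=> [be de ee] /eqP e0; apply: (mulfI e0); rewrite mulr1.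
by rewrite -[RHS](congr1 (fun T => entry T a a) ee) -(bop_diag _ _ be de).
Qed.

Lemma diag_idempotent_supp e : diag_idempotent e -> e <> 0 -> exists a, entry e a a <> 0.
Proof.
move=> [be de ee] e0; apply: contrapT => h; apply: e0.
apply: bop_ext => // [|a b]; first exact: bop_zero.
rewrite -[RHS]/(0 : R[i]); apply: contrapT => eab; apply: h.
by exists a; rewrite {2}(de _ _ eab).
Qed.

End matrix_units.

Section transport.
Context {X Y : metricType R} (hX : bounded_geometry X).
Local Notation A := (stable_Roe p1 X).
Local Notation B := (stable_Roe p1 Y).
Context (phi : (lp (X * nat)%type p1 -> lp (X * nat)%type p1) ->
               (lp (Y * nat)%type p1 -> lp (Y * nat)%type p1)).
Context (phi_iso : isometric_iso A B phi).

Lemma iso_maps a : A a -> B (phi a).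
Proof. by case: phi_iso => -[f _ _] _ _ _; exact: f. Qed.

Lemma iso_injective a b : A a -> A b -> phi a = phi b -> a = b.
Proof. by case: phi_iso => -[_ f _] _ _ _ Aa Ab; apply: f; rewrite inE. Qed.

Lemma iso0 : phi 0 = 0.
Proof.
have := iso_linear phi_iso (-1) stable_Roe0 stable_Roe0.
by rewrite scaler0 addr0 scaleN1r addNr.
Qed.

(** The image [e] of e_aa is a nonzero diagonal idempotent; let [c] lie in its support and let [h]
    be the preimage of e_cc in [P]. Then e_cc e = e_cc pulls back to h e_aa = h, so that the nonzero
    diagonal idempotent [h] equals e_aa, and e = e_cc. *)
Lemma iso_munit
    (P : set (lp (X * nat)%type p1 -> lp (X * nat)%type p1))
    (Q : set (lp (Y * nat)%type p1 -> lp (Y * nat)%type p1)) :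
  P `<=` A -> P `<=` diag_idempotent -> Q `<=` diag_idempotent ->
  (forall a, P (munit a a)) -> (forall c, Q (munit c c)) ->
  (forall e, P e -> Q (phi e)) -> (forall f, Q f -> exists2 e, P e & phi e = f) ->
  forall a, exists c, phi (munit a a) = munit c c.
Proof.
move=> PA Pd Qd Pm Qm PQ QP a.
have Qe := PQ _ (Pm a); set e := phi _ in Qe *.
have de := Qd _ Qe; have [be se ee] := de.
have [|c ec] := diag_idempotent_supp de.
  rewrite /e -iso0 => /(iso_injective (stable_Roe_munit _ _) stable_Roe0).
  exact: munit_neq0.
exists c.
have ec1 := diag_idempotent_entry de ec.
have [h Ph hc] := QP _ (Qm c).
have dh := Pd _ Ph; have [bh sh hh] := dh.
have Aa := stable_Roe_munit (p1 := p1) a a.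
have cee : munit c c \o e = munit c c.
  apply/funext => eta; rewrite -[LHS]/(e eta c *: delta p1 c) (bop_diag _ _ be se).
  by rewrite ec1 mul1r.
have Ah := PA _ Ph.
have hah : h \o munit a a = h.
  apply: (iso_injective (stable_Roe_comp Ah Aa) Ah).
  by rewrite (iso_mul phi_iso Ah Aa) hc -/e cee.
have [|b hb] := diag_idempotent_supp dh.
  by move=> h0; apply: (@munit_neq0 _ c c); rewrite -hc h0 iso0.
have hxy x y : entry h x y = (y == a)%:R * entry h x a.
  rewrite -[in LHS]hah /entry -[LHS]/(h (delta p1 y a *: delta p1 a) x).
  by rewrite (bopZ bh) lp_deltaE eq_sym.
have ba : b = a.
  by apply: contrapT => /eqP ba; apply: hb; rewrite hxy (negbTE ba) mul0r.
rewrite ba in hb; have ha1 := diag_idempotent_entry dh hb.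
suff mh : munit a a = h by rewrite /e mh hc.
apply: bop_ext => [||x y]; [exact: bop_munit|exact: bh|].
rewrite entry_munit hxy; have [->|xa] := eqVneq x a; first by rewrite ha1 mulr1.
have [->|/sh] := pselect (entry h x a = 0); first by rewrite mulr0.
by move=> xa'; rewrite xa' eqxx in xa.
Qed.

Lemma iso_entry (F : X * nat -> Y * nat) T a b :
  (forall a, phi (munit a a) = munit (F a) (F a)) -> A T ->
  normc (entry (phi T) (F a) (F b)) = normc (entry T a b).
Proof.
move=> phiF AT; have bT := stable_Roe_bop AT.
rewrite -(opn_scale_munit _ (F a) (F b)) -munit_sandwich; last exact/stable_Roe_bop/iso_maps.
have ATb := stable_Roe_comp AT (stable_Roe_munit (p1 := p1) b b).
rewrite -!phiF -(iso_mul phi_iso AT (stable_Roe_munit _ _)).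
rewrite -(iso_mul phi_iso (stable_Roe_munit _ _) ATb).
rewrite -opnE (iso_isometry phi_iso (stable_Roe_comp (stable_Roe_munit _ _) ATb)).
by rewrite opnE (munit_sandwich _ _ bT) opn_scale_munit.
Qed.

Lemma iso_controlled (F : X * nat -> Y * nat) :
  (forall a, phi (munit a a) = munit (F a) (F a)) -> controlled F.
Proof.
move=> phiF r n.
(* For negative [r] the band is empty, as distances are nonnegative. *)
have [r0|r0] := leP 0 r; last first.
  by exists 0, 0%N => a b [ab _ _]; have := le_lt_trans ab r0; rewrite ltNge mdist_ge0.
(* The image of the indicator of the band has modulus 1 at every [(F a, F b)] with [(a, b)] in the
   band, and such large entries fill only a band. *)
have [T AT T1] := ctl_indicator (p1 := p1) hX n r0.
have [r' [n' h]] := stable_Roe_large_entries (iso_maps AT).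
exists r', n' => a b ab; apply: h.
by rewrite (iso_entry _ _ phiF AT) T1// normc1.
Qed.

End transport.

(** [P] and [Q] are left abstract because two classes of idempotents are used: those of the Cartan
    subalgebras, and the hermitian ones when p is not 2. *)
Lemma rigidity (X Y : metricType R) (hX : bounded_geometry X) (hY : bounded_geometry Y)
    phi (P : set (lp (X * nat)%type p1 -> lp (X * nat)%type p1))
    (Q : set (lp (Y * nat)%type p1 -> lp (Y * nat)%type p1)) :
  isometric_iso (stable_Roe p1 X) (stable_Roe p1 Y) phi ->
  P `<=` stable_Roe p1 X -> Q `<=` stable_Roe p1 Y ->
  P `<=` diag_idempotent -> Q `<=` diag_idempotent ->
  (forall a, P (munit a a)) -> (forall c, Q (munit c c)) ->
  (forall e, P e -> Q (phi e)) -> (forall f, Q f -> exists2 e, P e & phi e = f) ->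
  stably_equivalent X Y.
Proof.
move=> phi_iso PA QB Pd Qd Pm Qm PQ QP.
have [psi [psi_iso phiK psiK]] := iso_inverse phi_iso stable_Roe_lin stable_Roe_comp.
have [F FE] := choice (iso_munit phi_iso PA Pd Qd Pm Qm PQ QP).
have QP' f : Q f -> P (psi f).
  by move=> /QP[e Pe <-]; rewrite phiK// inE; exact: PA.
have PQ' e : P e -> exists2 f, Q f & psi f = e.
  by move=> Pe; exists (phi e); [exact: PQ|rewrite phiK// inE; exact: PA].
have [G GE] := choice (iso_munit psi_iso QB Qd Pd Qm Pm QP' PQ').
exists F, G; split.
- move=> a; apply: munit_inj; rewrite -GE -FE phiK// inE; exact: stable_Roe_munit.
- move=> c; apply: munit_inj; rewrite -FE -GE psiK// inE; exact: stable_Roe_munit.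
- exact: (iso_controlled hX phi_iso FE).
- exact: (iso_controlled hY psi_iso GE).
Qed.

End rigidity.

(** * Clarkson's inequality and disjointness *)

Section power_inequalities.
Context {R : realType}.
Implicit Types q x y A B s t : R.

Lemma powR_midpoint q x y : 1 <= q -> 0 <= x -> 0 <= y ->
  2 * ((x + y) / 2) `^ q <= x `^ q + y `^ q.
Proof.
move=> q1 x0 y0.
have half0 : 0 <= 2^-1 :> R by lra.
have half1 : 2^-1 <= 1 :> R by lra.
pose h : {i01 R} := Itv01 half0 half1.
have mem (z : R) : 0 <= z -> z \in (`[0, +oo[%classic : set R).
  by move=> z0; rewrite inE/= in_itv/= z0.
have := convex_powR q1 h (mem _ x0) (mem _ y0).
rewrite !convRE /= /unstable.onem.
have -> : 1 - 2^-1 = 2^-1 :> R by lra.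
set m := conv _ _ _; have -> : m = (x + y) / 2.
  by apply: etrans (convRE x y h) _; rewrite /= /unstable.onem; lra.
lra.
Qed.

Lemma powR_lt_self q x : 1 < q -> 0 < x -> x < 1 -> x `^ q < x.
Proof.
move=> q1 x0 x1; rewrite -(mulr_powRB1 (ltW x0)); last exact: lt_trans q1.
rewrite -[ltRHS]mulr1 ltr_pM2l//.
have q10 : 0 < q - 1 by rewrite subr_gt0.
have := gt0_ltr_powR q10 _ _ x1; rewrite powR1; apply; rewrite nnegrE//.
exact: ltW.
Qed.

(** Divided by A + B, both numbers become fractions in (0, 1), which strictly decrease under the
    q-th power; the fractions add up to 1. *)
Lemma powR_superadditive q A B : 1 < q -> 0 < A -> 0 < B ->
  A `^ q + B `^ q < (A + B) `^ q.
Proof.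
move=> q1 A0 B0; have C0 : 0 < A + B by rewrite addr_gt0.
have frac D E : 0 < D -> 0 < E -> D `^ q < (D + E) `^ q * (D / (D + E)).
  move=> D0 E0; have DE : 0 < D + E by rewrite addr_gt0.
  have -> : D `^ q = (D + E) `^ q * (D / (D + E)) `^ q.
    rewrite -powRM ?divr_ge0 ?ltW// mulrCA mulfV ?mulr1// gt_eqF//.
  rewrite ltr_pM2l ?powR_gt0//; apply: powR_lt_self => //; first exact: divr_gt0.
  by rewrite ltr_pdivrMr// mul1r ltrDl.
have h1 := frac A B A0 B0; have := frac B A B0 A0; rewrite [B + A]addrC => h2.
apply: lt_le_trans (ltrD h1 h2) _.
by rewrite -mulrDr -mulrDl mulfV ?mulr1// gt_eqF.
Qed.

(** Superadditivity for the exponent 1 / q, applied to A^q and B^q. *)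
Lemma powR_subadditive q A B : 0 < q -> q < 1 -> 0 < A -> 0 < B ->
  (A + B) `^ q < A `^ q + B `^ q.
Proof.
move=> q0 q1 A0 B0.
have r1 : 1 < q^-1 by rewrite invf_gt1.
have := powR_superadditive r1 (powR_gt0 q A0) (powR_gt0 q B0).
rewrite -!powRrM mulfV ?gt_eqF// !powRr1 ?ltW// => h.
have := gt0_ltr_powR q0 _ _ h; rewrite -powRrM mulVf ?gt_eqF// powRr1.
  by apply; rewrite ?nnegrE ?addr_ge0 ?powR_ge0// ltW.
by rewrite addr_ge0 ?powR_ge0.
Qed.

(** Convexity gives s^q + t^q >= 2 (A + B)^q, and superadditivity finishes. With A, B, s, t the
    squared moduli in the parallelogram law and q = p / 2, this becomes Clarkson's inequality. *)
Lemma powR_parallelogram_gt q A B s t : 1 < q -> 0 < A -> 0 < B ->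
  0 <= s -> 0 <= t -> s + t = 2 * (A + B) ->
  2 * (A `^ q + B `^ q) < s `^ q + t `^ q.
Proof.
move=> q1 A0 B0 s0 t0 st.
have h1 := powR_superadditive q1 A0 B0.
have := powR_midpoint (ltW q1) s0 t0.
have -> : (s + t) / 2 = A + B by lra.
lra.
Qed.

(** For q < 1 convexity of the power 1 / q, applied to s^q and t^q, bounds their mean by (A +
    B)^q. *)
Lemma powR_parallelogram_lt q A B s t : 0 < q -> q < 1 -> 0 < A -> 0 < B ->
  0 <= s -> 0 <= t -> s + t = 2 * (A + B) ->
  s `^ q + t `^ q < 2 * (A `^ q + B `^ q).
Proof.
move=> q0 q1 A0 B0 s0 t0 st.
have r1 : 1 < q^-1 by rewrite invf_gt1.
have h1 := powR_subadditive q0 q1 A0 B0.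
have := powR_midpoint (ltW r1) (powR_ge0 s q) (powR_ge0 t q).
rewrite -!powRrM mulfV ?gt_eqF// !powRr1// st.
set m := (s `^ q + t `^ q) / 2 => h.
have m0 : 0 <= m by rewrite divr_ge0 ?addr_ge0 ?powR_ge0.
have h2 : m `^ q^-1 <= A + B by lra.
have := ge0_ler_powR (ltW q0) _ _ h2.
rewrite -powRrM mulVf ?gt_eqF// powRr1// !nnegrE => /(_ (powR_ge0 _ _)).
move=> /(_ (addr_ge0 (ltW A0) (ltW B0))); rewrite /m; lra.
Qed.

Lemma normc_sqr (z : R[i]) : normc z ^+ 2 = complex.Re z ^+ 2 + complex.Im z ^+ 2.
Proof. by case: z => a b /=; rewrite sqr_sqrtr// addr_ge0 ?sqr_ge0. Qed.

Lemma normc_parallelogram (u v : R[i]) :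
  normc (u + v) ^+ 2 + normc (u - v) ^+ 2 = 2 * (normc u ^+ 2 + normc v ^+ 2).
Proof. by rewrite !normc_sqr; case: u v => a b [c d] /=; ring. Qed.

Lemma normc_gt0 (z : R[i]) : z != 0 -> 0 < normc z.
Proof.
move=> z0; rewrite lt_neqAle normc_ge0 andbT eq_sym.
by apply: contra z0 => /eqP/eq0_normc ->.
Qed.

Lemma powR_normc_sqr (p : R) (z : R[i]) : normc z `^ p = (normc z ^+ 2) `^ (p / 2).
Proof.
rewrite -powR_mulrn ?normc_ge0// -powRrM; congr (_ `^ _).
by rewrite mulrCA mulfV ?mulr1// pnatr_eq0.
Qed.

Lemma clarkson_gt (p : R) (u v : R[i]) : 2 < p -> u * v != 0 ->
  2 * (normc u `^ p + normc v `^ p) < normc (u + v) `^ p + normc (u - v) `^ p.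
Proof.
move=> p2; rewrite mulf_eq0 negb_or => /andP[u0 v0]; rewrite !(powR_normc_sqr p).
apply: powR_parallelogram_gt; rewrite ?exprn_gt0 ?normc_gt0 ?sqr_ge0//.
- by rewrite ltr_pdivlMr// mul1r.
- exact: normc_parallelogram.
Qed.

Lemma clarkson_lt (p : R) (u v : R[i]) : 0 < p -> p < 2 -> u * v != 0 ->
  normc (u + v) `^ p + normc (u - v) `^ p < 2 * (normc u `^ p + normc v `^ p).
Proof.
move=> p0 p2; rewrite mulf_eq0 negb_or => /andP[u0 v0]; rewrite !(powR_normc_sqr p).
apply: powR_parallelogram_lt; rewrite ?exprn_gt0 ?normc_gt0 ?sqr_ge0//.
- by rewrite divr_gt0.
- by rewrite ltr_pdivrMr// mul1r.
- exact: normc_parallelogram.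
Qed.

Lemma clarkson_eq (p : R) (u v : R[i]) : p != 0 -> u * v = 0 ->
  normc (u + v) `^ p + normc (u - v) `^ p = 2 * (normc u `^ p + normc v `^ p).
Proof.
move=> p0 /eqP; rewrite mulf_eq0 => /orP[]/eqP ->.
  by rewrite add0r sub0r normcN normc0 powR0// add0r mulr_natl mulr2n.
by rewrite addr0 subr0 normc0 powR0// addr0 mulr_natl mulr2n.
Qed.

(** The common sum is finite, so it can be cancelled; the nonnegative differences then sum to 0. *)
Lemma esum_eq_le (I : choiceType) (f g : I -> R) :
  (forall i, 0 <= f i) -> (forall i, f i <= g i) ->
  (\esum_(i in [set: I]) (g i)%:E < +oo)%E ->
  (\esum_(i in [set: I]) (f i)%:E = \esum_(i in [set: I]) (g i)%:E)%E ->
  forall i, f i = g i.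
Proof.
move=> f0 fg gfin fgE i; apply/eqP; rewrite eq_le fg/= -subr_le0 -lee_fin.
have d0 j : (0 <= (g j - f j)%:E)%E by rewrite lee_fin subr_ge0.
have split : (\esum_(i in [set: I]) (g i)%:E = \esum_(i in [set: I]) (f i)%:E +
    \esum_(i in [set: I]) (g i - f i)%:E)%E.
  rewrite -esumD => [|j _|j _]; rewrite ?lee_fin//; last exact: d0.
  by apply: eq_esum => j _; rewrite -EFinD addrC subrK.
have dsum0 : (\esum_(i in [set: I]) (g i - f i)%:E)%E = 0%E.
  have gf : (\esum_(i in [set: I]) (g i)%:E)%E \is a fin_num.
    by rewrite ge0_fin_numE// esum_ge0// => j _; rewrite lee_fin (le_trans (f0 j)).
  move: split; rewrite fgE => /esym/eqP; rewrite -[X in _ == X -> _]adde0.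
  case: (esum _ _) gf => // r _; case: (esum _ _) => // s.
  by rewrite -EFinD eqe addr0 => /eqP h; congr EFin; lra.
rewrite -[leRHS]dsum0 (esumID [set i]) => [|j _]; last exact: d0.
rewrite setTI esum_set1; last exact: d0.
by rewrite leeDl// esum_ge0.
Qed.

End power_inequalities.

Section lp_clarkson.
Context {R : realType} {p : R} {p1 : 1 <= p} {I : choiceType}.
Implicit Types u v : lp I p1.

Let G u v i : R := 2 * (normc (u i) `^ p + normc (v i) `^ p).
Let D u v i : R := normc (u i + v i) `^ p + normc (u i - v i) `^ p.

Let G_ge0 u v i : 0 <= G u v i.
Proof. by rewrite mulr_ge0 ?addr_ge0 ?powR_ge0. Qed.

Let D_ge0 u v i : 0 <= D u v i.
Proof. by rewrite addr_ge0 ?powR_ge0. Qed.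

Let esum_G u v :
  (\esum_(i in [set: I]) (G u v i)%:E)%E = (2 * (lpn u `^ p + lpn v `^ p))%:E.
Proof.
under eq_esum => i _ do rewrite /G mulr_natl mulr2n !EFinD.
have ge0 (w : lp I p1) i : (0 <= (normc (w i) `^ p)%:E)%E by rewrite lee_fin powR_ge0.
rewrite !esumD => [|*|*|*|*]; rewrite ?adde_ge0//.
by rewrite -/(lp_sum p u) -/(lp_sum p v) !lp_sumE -!EFinD mulr_natl mulr2n.
Qed.

Let esum_D u v :
  (\esum_(i in [set: I]) (D u v i)%:E)%E = (lpn (u + v) `^ p + lpn (u - v) `^ p)%:E.
Proof.
under eq_esum => i _ do rewrite /D EFinD.
have ge0 (w : lp I p1) i : (0 <= (normc (w i) `^ p)%:E)%E by rewrite lee_fin powR_ge0.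
rewrite esumD => [|i _|i _]; [|exact: (ge0 (u + v))|exact: (ge0 (u - v))].
by rewrite EFinD -!lp_sumE.
Qed.

Lemma lp_clarkson_eq u v : (forall i, u i * v i = 0) ->
  lpn (u + v) `^ p + lpn (u - v) `^ p = 2 * (lpn u `^ p + lpn v `^ p).
Proof.
move=> uv; apply: EFin_inj; rewrite -esum_G -esum_D.
by apply: eq_esum => i _; rewrite /D /G clarkson_eq// p_neq0.
Qed.

(** For p other than 2 the pointwise inequality has the same direction at every coordinate and is
    strict wherever the product is nonzero. Equality of the sums forces equality at each
    coordinate. *)
Lemma lp_clarkson_disjoint u v : p != 2 ->
  lpn (u + v) `^ p + lpn (u - v) `^ p = 2 * (lpn u `^ p + lpn v `^ p) ->
  forall i, u i * v i = 0.
Proof.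
move=> p2 uv i; apply: contrapT => /eqP uvi.
have GD : (\esum_(i in [set: I]) (G u v i)%:E = \esum_(i in [set: I]) (D u v i)%:E)%E.
  by rewrite esum_G esum_D uv.
have Glt : (\esum_(i in [set: I]) (G u v i)%:E < +oo)%E by rewrite esum_G ltry.
have Dlt : (\esum_(i in [set: I]) (D u v i)%:E < +oo)%E by rewrite -GD.
move: p2; rewrite neq_lt => /orP[p2|p2].
  have DG j : D u v j <= G u v j.
    have [uv0|uv0] := eqVneq (u j * v j) 0; first by rewrite /D clarkson_eq// p_neq0.
    by apply: ltW; apply: clarkson_lt => //; exact: p_gt0 p1.
  have := clarkson_lt (p_gt0 p1) p2 uvi.
  by rewrite -/(D u v i) -/(G u v i) (esum_eq_le (D_ge0 u v) DG Glt (esym GD)) ltxx.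
have DG j : G u v j <= D u v j.
  have [uv0|uv0] := eqVneq (u j * v j) 0; first by rewrite /D clarkson_eq// p_neq0.
  by apply: ltW; exact: clarkson_gt.
have := clarkson_gt p2 uvi.
by rewrite -/(D u v i) -/(G u v i) (esum_eq_le (G_ge0 u v) DG Dlt GD) ltxx.
Qed.

End lp_clarkson.

(** * Hermitian idempotents *)

Section hermitian_idempotents.
Context {R : realType} {p : R} {p1 : 1 <= p}.

(* The operators 1 + (z - 1) e act isometrically on A by left multiplication;
   this makes sense although A has no unit, and isometric isomorphisms
   preserve it. *)
Definition hermitian_idempotent {I : choiceType} (A : set (lp I p1 -> lp I p1)) :
    set (lp I p1 -> lp I p1) :=
  [set e | [/\ A e, e \o e = e & forall z : R[i], normc z = 1 ->
     forall a, A a -> opn ((z - 1) *: (e \o a) + a) = opn a]].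

Lemma iso_hermitian {I J : choiceType} (A : set (lp I p1 -> lp I p1))
    (B : set (lp J p1 -> lp J p1)) phi e :
  isometric_iso A B phi ->
  (forall c a b, A a -> A b -> A (c *: a + b)) ->
  (forall a b, A a -> A b -> A (a \o b)) ->
  hermitian_idempotent A e -> hermitian_idempotent B (phi e).
Proof.
move=> phi_iso Alin Acomp [Ae ee he].
have [[phiA _ phi_surj] phi_lin phi_mul phi_norm] := phi_iso.
split; [exact: phiA|by rewrite -phi_mul// ee|move=> z z1 b Bb].
have [a Aa <-] := phi_surj _ Bb.
have Aea := Acomp _ _ Ae Aa.
rewrite -(phi_mul _ _ Ae Aa) -(phi_lin _ _ _ Aea Aa) -!opnE.
by rewrite (phi_norm _ (Alin _ _ _ Aea Aa)) (phi_norm _ Aa) !opnE; exact: he.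
Qed.

Context {X : metricType R}.
Local Notation A := (stable_Roe p1 X).

(** Here 1 + (z - 1) e multiplies the coordinate at [a] by [z] and fixes all others, so it preserves
    moduli. *)
Lemma hermitian_munit a : hermitian_idempotent A (munit a a).
Proof.
split; first exact: stable_Roe_munit.
  apply/funext => xi; rewrite -[LHS]/((xi a *: delta p1 a) a *: delta p1 a).
  by rewrite lp_scaleE lp_deltaE eqxx mulr1.
move=> z z1 T AT; apply: eq_opn => xi; apply: lpn_eq.
apply: eq_esum => i _; congr ((_ `^ _)%:E).
rewrite -[X in normc X]/((z - 1) * (T xi a * (i == a)%:R) + T xi i).
have [->|ia] := eqVneq i a; last by rewrite !mulr0 add0r.
by rewrite mulr1 mulrBl mul1r subrK normcM z1 mul1r.
Qed.

(** The operator whose only nonzero column, at [o], is [xi]. Its norm is that of [xi], which carries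
    isometry statements from operators over to vectors. *)
Definition rank_one (xi : lp (X * nat)%type p1) (o : X * nat)
  (zeta : lp (X * nat)%type p1) := zeta o *: xi.

Lemma opn_rank_one xi o : opn (rank_one xi o) = lpn xi.
Proof.
have brank : bop (rank_one xi o).
  apply: (@bop_of_bound _ _ _ _ _ (lpn xi)) => [c u v|].
    by rewrite /rank_one lp_addE lp_scaleE scalerDl scalerA.
  split=> zeta; rewrite lpnZ mulrC.
  by apply: ler_wpM2l; [exact: lpn_ge0|exact: lp_coord_le].
apply/eqP; rewrite eq_le; apply/andP; split.
  apply: opn_le; first exact: lpn_ge0.
  split=> zeta; rewrite lpnZ mulrC.
  by apply: ler_wpM2l; [exact: lpn_ge0|exact: lp_coord_le].
have := opn_ub (delta p1 o) brank.
by rewrite lpn_delta mulr1 /rank_one lp_deltaE eqxx scale1r.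
Qed.

(** The rank-one operator with column [xi] belongs to the algebra, and left multiplication by 1 + (z
    - 1) e replaces the column by its image. *)
Lemma hermitian_isometry e (z c : R[i]) a b : hermitian_idempotent A e ->
  normc z = 1 ->
  lpn ((z - 1) *: e (c *: delta p1 a + delta p1 b) + (c *: delta p1 a + delta p1 b)) =
  lpn (c *: delta p1 a + delta p1 b).
Proof.
move=> [Ae _ he] z1; set xi := c *: delta p1 a + delta p1 b.
have be := stable_Roe_bop Ae.
have Axi : A (rank_one xi a).
  have -> : rank_one xi a = c *: munit a a + munit b a.
    apply/funext => zeta; rewrite /rank_one /xi scalerDr scalerA mulrC -scalerA.
    by [].
  apply: stable_Roe_lin; exact: stable_Roe_munit.
rewrite -(opn_rank_one xi a) -(he z z1 _ Axi) -(opn_rank_one _ a); congr opn.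
apply/funext => zeta; rewrite -[RHS]/((z - 1) *: e (zeta a *: xi) + zeta a *: xi).
by rewrite (bopZ be) /rank_one scalerDr !scalerA mulrC.
Qed.

Lemma hermitian_diag e : p != 2 -> hermitian_idempotent A e -> diag_idempotent e.
Proof.
move=> p2 he; have [Ae ee _] := he; have be := stable_Roe_bop Ae.
split=> // a b eab; apply: contrapT => /eqP ab; apply: eab.
pose V z xi := (z - 1) *: e xi + xi : lp (X * nat)%type p1.
have VD z xi eta c : V z (c *: xi + eta) = c *: V z xi + V z eta.
  rewrite /V (bop_linear be) !scalerDr !scalerA [c * (z - 1)]mulrC.
  by rewrite addrACA.
(* [V z] keeps the norms of the two basis vectors and of their sum and difference, so Clarkson's
   equality passes from these disjoint vectors to their images. *)
have disj z : normc z = 1 -> forall i, V z (delta p1 a) i * V z (delta p1 b) i = 0.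
  move=> z1 i; rewrite mulrC; move: i; apply: (lp_clarkson_disjoint p2).
  have iso c x y : lpn (V z (c *: delta p1 x + delta p1 y)) = lpn (c *: delta p1 x + delta p1 y).
    exact: hermitian_isometry.
  have isod x : lpn (V z (delta p1 x)) = lpn (delta p1 x).
    by have := iso 0 x x; rewrite scale0r add0r.
  have -> : V z (delta p1 b) + V z (delta p1 a) = V z (1 *: delta p1 a + delta p1 b).
    by rewrite VD scale1r addrC.
  have -> : V z (delta p1 b) - V z (delta p1 a) = V z ((-1) *: delta p1 a + delta p1 b).
    by rewrite VD scaleN1r addrC.
  rewrite !iso !isod scale1r scaleN1r [delta p1 a + _]addrC [- _ + _]addrC.
  apply: lp_clarkson_eq => i; rewrite !lp_deltaE.
  by case: (eqVneq i b) => [->|]; rewrite ?mul0r// eq_sym (negbTE ab) mulr0.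
set x := entry e a a; set y := entry e a b.
have key z : normc z = 1 -> ((z - 1) * x + 1) * ((z - 1) * y) = 0.
  move=> z1; have := disj z z1 a.
  rewrite -[V z _ a]/((z - 1) * x + (a == a)%:R).
  rewrite -[V z (delta p1 b) a]/((z - 1) * y + (a == b)%:R).
  by rewrite eqxx (negbTE ab) addr0.
apply/eqP; apply: contraT => y0.
(* If y were nonzero, (1 - z) x = 1 would hold for every unimodular z other than 1. The values z =
   -1 and z = i are incompatible: subtraction gives (i + 1) x = 0, hence x = 0. *)
have unit z : normc z = 1 -> z != 1 -> (z - 1) * x + 1 = 0.
  move=> z1 zn1; apply/eqP; have /eqP := key z z1.
  by rewrite !mulf_eq0 (negbTE y0) subr_eq0 (negbTE zn1) !orbF.
have h1 : (-1 - 1) * x + 1 = 0.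
  apply: unit; first by rewrite normcN normc1.
  by rewrite eq_sym -subr_eq0 opprK -mulr2n pnatr_eq0.
have i1 : normc ('i%C : R[i]) = 1 by rewrite /= expr0n add0r expr1n sqrtr1.
have h2 : ('i%C - 1) * x + 1 = 0.
  apply: unit => //; apply/negP => /eqP/(congr1 (@complex.Re R))/= /eqP.
  by rewrite eq_sym oner_eq0.
have x0 : ('i%C + 1) * x = 0.
  have -> : ('i%C + 1) * x = ('i%C - 1) * x + 1 - ((-1 - 1) * x + 1) by ring.
  by rewrite h1 h2 subrr.
have in1 : 'i%C + 1 != 0 :> R[i].
  apply/negP => /eqP/(congr1 (@complex.Im R))/= /eqP.
  by rewrite addr0 oner_eq0.
move/eqP: x0; rewrite mulf_eq0 (negbTE in1) => /eqP x0.
by move/eqP: h1; rewrite x0 mulr0 add0r oner_eq0.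
Qed.

End hermitian_idempotents.

(** * The two classes of idempotents that determine the bijection *)

Section preserved_classes.
Context {R : realType} {p : R} {p1 : 1 <= p} {X Y : metricType R}.
Context (hX : bounded_geometry X) (hY : bounded_geometry Y).

Lemma stably_equivalent_of_iso phi : p != 2 ->
  isometric_iso (stable_Roe p1 X) (stable_Roe p1 Y) phi -> stably_equivalent X Y.
Proof.
move=> p2 phi_iso.
have [psi [psi_iso phiK psiK]] := iso_inverse phi_iso stable_Roe_lin stable_Roe_comp.
apply: (@rigidity _ _ p1 _ _ hX hY phi (hermitian_idempotent (stable_Roe p1 X))
  (hermitian_idempotent (stable_Roe p1 Y))) => //.
- by move=> e [].
- by move=> e [].
- by move=> e; exact: hermitian_diag.
- by move=> e; exact: hermitian_diag.
- exact: hermitian_munit.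
- exact: hermitian_munit.
- by move=> e; exact: (iso_hermitian phi_iso stable_Roe_lin stable_Roe_comp).
- move=> f hf; exists (psi f).
    exact: (iso_hermitian psi_iso stable_Roe_lin stable_Roe_comp).
  by rewrite psiK// inE; case: hf.
Qed.

(** Vanishing of the off-diagonal entries survives norm limits, because the norm bounds every
    entry. *)
Lemma stable_Cartan_diag Z : stable_Cartan p1 Z `<=` [set T | bop T /\ supported eq T].
Proof.
move=> T; rewrite stable_CartanE => /(norm_closureP _ (@banded_bop _ _ _ _ _))[bT TA].
split=> // a b Tab; apply: contrapT => ab; apply: Tab.
apply: eq0_normc; apply/eqP; rewrite eq_le normc_ge0 andbT.
apply/ler_addgt0Pr => e e0; rewrite add0r.
have [S [bS [_ [n ->] SW]] TS] := TA _ e0.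
have Sab : entry S a b = 0 by apply: contrapT => /SW[].
have -> : entry T a b = entry (T - S) a b.
  by rewrite -[RHS]/(entry T a b - entry S a b) Sab subr0.
apply: le_trans (entry_le_opn a b (bop_sub bT bS)) _.
by apply: opn_le => //; exact: ltW.
Qed.

Lemma stable_Cartan_munit Z a : stable_Cartan p1 Z (munit a a).
Proof.
rewrite stable_CartanE; apply: sub_norm_closure; first exact: banded_bop.
split; first exact: bop_munit.
exists (fun x y => x = y /\ (x.2 < a.2.+1)%N); first by exists a.2.+1.
by move=> x y; rewrite entry_munit; case: eqP => [->|//]; case: eqP => [->|//].
Qed.

Lemma stable_Cartan_sub Z : stable_Cartan p1 Z `<=` stable_Roe p1 Z.
Proof.
rewrite stable_CartanE stable_RoeE; apply: norm_closure_sub; [exact: banded_bop..|].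
move=> T [bT [_ [n ->] Tn]]; apply: sub_norm_closure; first exact: banded_bop.
split=> //; exists (ctl 0 n); first by exists 0, n.
by move=> a b /Tn[<- an]; split=> //; rewrite mdistxx.
Qed.

Lemma stably_equivalent_of_Cartan_iso phi :
  isometric_iso (stable_Roe p1 X) (stable_Roe p1 Y) phi ->
  phi @` stable_Cartan p1 X = stable_Cartan p1 Y -> stably_equivalent X Y.
Proof.
move=> phi_iso phiC.
have phi_mul := iso_mul phi_iso.
apply: (@rigidity _ _ p1 _ _ hX hY phi [set e | stable_Cartan p1 X e /\ e \o e = e]
  [set e | stable_Cartan p1 Y e /\ e \o e = e]) => //.
- by move=> e [/stable_Cartan_sub].
- by move=> e [/stable_Cartan_sub].
- by move=> e [/stable_Cartan_diag[be de] ee].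
- by move=> e [/stable_Cartan_diag[be de] ee].
- move=> a; split; first exact: stable_Cartan_munit.
  by have [] := hermitian_munit (p1 := p1) a.
- move=> a; split; first exact: stable_Cartan_munit.
  by have [] := hermitian_munit (p1 := p1) a.
- move=> e [Ce ee]; split; first by rewrite -phiC; exists e.
  by rewrite -phi_mul ?ee//; exact: stable_Cartan_sub.
- move=> f [Cf ff]; have [e Ce ef] : (phi @` stable_Cartan p1 X) f by rewrite phiC.
  exists e => //; split=> //.
  have Ae := stable_Cartan_sub Ce.
  apply: (iso_injective phi_iso (stable_Roe_comp Ae Ae) Ae).
  by rewrite phi_mul// ef ff.
Qed.

End preserved_classes.

(** * Conjugation by a bijection and coarse equivalence *)

Section conjugation.
Context {R : realType} {p : R} {p1 : 1 <= p} {I J : choiceType}.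
Context (F : I -> J) (G : J -> I) (FK : cancel F G) (GK : cancel G F).

(** Conjugation by the isometry [pull G], which sends the basis vector at [a] to the one at [F a];
    its inverse is [pull F]. *)
Definition conj_op (T : lp I p1 -> lp I p1) : lp J p1 -> lp J p1 :=
  pull G \o (T \o pull F).

Let bijF : bijective F. Proof. by exists G. Qed.
Let bijG : bijective G. Proof. by exists F. Qed.

Lemma op_bound_conj T M : op_bound T M -> op_bound (conj_op T) M.
Proof.
move=> TM; split=> xi; rewrite -[conj_op T xi]/(pull G (T (pull F xi))).
by rewrite pull_norm// -(pull_norm bijF xi) (op_boundP TM).
Qed.

Lemma bop_conj T : bop T -> bop (conj_op T).
Proof.
move=> bT; have [M M0 TM] := bopP bT.
apply: bop_of_bound (op_bound_conj TM) => c xi eta.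
by rewrite /conj_op/= (pull_linear bijF) (bop_linear bT) (pull_linear bijG).
Qed.

Lemma conj_lin (c : R[i]) T S : conj_op (c *: T + S) = c *: conj_op T + conj_op S.
Proof. by apply/funext => xi; rewrite /conj_op/= (pull_linear bijG). Qed.

Lemma conj_mul T S : conj_op (T \o S) = conj_op T \o conj_op S.
Proof. by apply/funext => xi; rewrite /conj_op/= pullK. Qed.

Lemma entry_conj T a b : entry (conj_op T) a b = entry T (G a) (G b).
Proof.
by rewrite /entry /conj_op/= (pullE bijG) -{1}(GK b) pull_delta.
Qed.

Lemma conj_norm_closure E E' : 
  (forall W, E W -> exists2 W', E' W' & forall a b, W a b -> W' (F a) (F b)) ->
  forall T, norm_closure (banded E) T -> norm_closure (banded E') (conj_op T).
Proof.
move=> EE T /(norm_closureP _ (@banded_bop _ _ _ _ _))[bT TA].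
apply/(norm_closureP _ (@banded_bop _ _ _ _ _)); split=> [|e e0]; first exact: bop_conj.
have [S [bS [W EW SW]] TS] := TA e e0; exists (conj_op S).
  split; first exact: bop_conj.
  have [W' EW' WW] := EE W EW; exists W' => // a b.
  by rewrite entry_conj => /SW/WW; rewrite !GK.
have -> : conj_op T - conj_op S = conj_op (T - S).
  by rewrite addrC -scaleN1r -conj_lin scaleN1r addrC.
exact: op_bound_conj.
Qed.

Lemma opn_conj_le T : bop T -> opn (conj_op T) <= opn T.
Proof.
move=> bT; apply: opn_le; first exact: opn_ge0.
by apply: op_bound_conj; split=> xi; exact: opn_ub.
Qed.

End conjugation.

Lemma conj_opK {R : realType} {p : R} {p1 : 1 <= p} {I J : choiceType}
    (F : I -> J) (G : J -> I) : cancel F G -> cancel G F ->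
  cancel (@conj_op R p p1 I J F G) (conj_op G F).
Proof.
move=> FK GK T; apply/funext => xi.
by rewrite -[LHS]/(pull F (pull G (T (pull F (pull G xi))))) !pullK.
Qed.

Lemma iso_of_stably_equivalent {R : realType} {p : R} (p1 : 1 <= p) (X Y : metricType R) :
  stably_equivalent X Y -> exists phi,
    isometric_iso (stable_Roe p1 X) (stable_Roe p1 Y) phi /\
    phi @` stable_Cartan p1 X = stable_Cartan p1 Y.
Proof.
move=> [F [G [FK GK cF cG]]].
have ctl_map (Z Z' : metricType R) (H : Z * nat -> Z' * nat) : controlled H ->
    forall W, @ctl_bands R Z W -> exists2 W', @ctl_bands R Z' W' &
      forall a b, W a b -> W' (H a) (H b).
  move=> cH _ [r [n ->]]; have [r' [n' h]] := cH r n.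
  by exists (ctl r' n') => //; exists r', n'.
have diag_map (Z Z' : metricType R) (H : Z * nat -> Z' * nat) : controlled H ->
    forall W, @diag_bands Z W -> exists2 W', @diag_bands Z' W' &
      forall a b, W a b -> W' (H a) (H b).
  (* Equal points stay equal, so only the level must be bounded: the band of radius 0 contains every
     pair (a, a) below level [n]. *)
  move=> cH _ [n ->]; have [r' [n' h]] := cH 0 n.
  exists (fun a b => a = b /\ (a.2 < n')%N); first by exists n'.
  move=> a b [<- an]; split=> //.
  by have [|//] := h a a; split=> //; rewrite mdistxx.
have FC := conj_norm_closure (p1 := p1) FK GK (ctl_map _ _ _ cF).
have GC := conj_norm_closure (p1 := p1) GK FK (ctl_map _ _ _ cG).
have FD := conj_norm_closure (p1 := p1) FK GK (diag_map _ _ _ cF).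
have GD := conj_norm_closure (p1 := p1) GK FK (diag_map _ _ _ cG).
have FGK := @conj_opK R p p1 _ _ _ _ FK GK.
have GFK := @conj_opK R p p1 _ _ _ _ GK FK.
exists (conj_op F G); rewrite !stable_RoeE !stable_CartanE; split; last first.
  apply/seteqP; split=> [_ [T DT <-]|T DT]; first exact: FD.
  by exists (conj_op G F T); [exact: GD|exact: GFK].
split.
- split=> [T|T S _ _ TS|T AT]; [exact: FC|by rewrite -(FGK T) TS FGK|].
  by exists (conj_op G F T); [exact: GC|exact: GFK].
- by move=> c a b _ _; exact: conj_lin.
- by move=> a b _ _; exact: conj_mul.
- move=> T /norm_closure_bounded bT; rewrite !opnE.
  apply/eqP; rewrite eq_le (opn_conj_le FK GK bT)/=.
  by have := opn_conj_le GK FK (bop_conj FK GK bT); rewrite FGK.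
Qed.

(* The Cantor-Bernstein bijection agrees at each point with one of the two
   injections, which is what keeps it at bounded distance from them. *)
Lemma Cantor_Bernstein_pointwise (A B : Type) (i : A -> B) (j : B -> A) :
  injective i -> injective j -> exists (F : A -> B) (G : B -> A),
    [/\ cancel F G, cancel G F & forall a, F a = i a \/ a = j (F a)].
Proof.
move=> ii ij.
(* [S] consists of the points whose backward chain ends outside the range of [j]. There [F] is [i];
   elsewhere it inverts [j]. *)
pose S a := exists n a0, (forall c, j c <> a0) /\ a = iter n (j \o i) a0.
have Fex a : exists c, (S a /\ c = i a) \/ (~ S a /\ a = j c).
  have [Sa|nSa] := pselect (S a); first by exists (i a); left.
  have [[c ac]|nac] := pselect (exists c, a = j c); first by exists c; right.
  by case: nSa; exists 0%N, a; split=> // c ca; apply: nac; exists c.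
have [F FE] := choice Fex.
have SF a : S a -> F a = i a by have [[]//|[nSa _]] := FE a => /nSa.
have nSF a : ~ S a -> a = j (F a) by have [[Sa _]|[_]//] := FE a => /(_ Sa).
have Sji a : S a -> S (j (i a)).
  by move=> [n [a0 [h ->]]]; exists n.+1, a0.
have surj c : exists a, F a = c.
  (* If [j c] lies in [S], its chain has positive length, as [j c] is in the range of [j]; the
     preceding point of the chain maps to [c]. *)
  have [[[|n] [a0 [h jc]]]|nS] := pselect (S (j c)).
  - by case: (h c).
  - exists (iter n (j \o i) a0); rewrite SF; last by exists n, a0.
    by apply: ij; rewrite jc.
  - by exists (j c); apply: ij; rewrite -nSF.
have inj : injective F.
  move=> a b ab; have [Sa|Sa] := pselect (S a); have [Sb|Sb] := pselect (S b).
  - by apply: ii; rewrite -!SF.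
  - by case: (Sb); rewrite (nSF b Sb) -ab SF//; exact: Sji.
  - by case: (Sa); rewrite (nSF a Sa) ab SF//; exact: Sji.
  - by rewrite (nSF a Sa) (nSF b Sb) ab.
have [G GE] := choice surj.
exists F, G; split=> [a|//|a]; first by apply: inj.
by have [[_]|[_]] := FE a; [left|right].
Qed.

(** * Coarse equivalence versus stable equivalence *)

Section coarse_equivalence.
Context {R : realType}.

(** Each fiber lies in the ball of radius [C] around one of its points; the index is the position in
    an enumeration of that ball. *)
Lemma fiber_index (X : metricType R) (Y : Type) (f : X -> Y) (C : R) :
  bounded_geometry X -> 0 <= C ->
  (forall x x', f x = f x' -> mdist x x' <= C) ->
  exists (N : nat) (idx : X -> nat), (forall x, (idx x < N)%N) /\
    forall x x', f x = f x' -> idx x = idx x' -> x = x'.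
Proof.
move=> hX C0 fC; have [N hN] := ball_seqP hX C0.
have ex y : exists h : X -> nat, (forall x, f x = y -> (h x < N)%N) /\
    forall x x', f x = y -> f x' = y -> h x = h x' -> x = x'.
  have [[x0 fx0]|no] := pselect (exists x, f x = y); last first.
    by exists (fun=> 0%N); split=> [x fx|x x' fx]; exfalso; apply: no; exists x.
  have [_ sN mem] := hN x0.
  have fiber x : f x = y -> x \in ball_seq C x0.
    by move=> fx; rewrite mem; apply: fC; rewrite fx0 fx.
  exists (fun x => index x (ball_seq C x0)); split=> [x fx|x x' fx fx'].
    by apply: leq_trans sN; rewrite index_mem fiber.
  by move=> e; rewrite -[LHS](nth_index x0 (fiber _ fx)) e nth_index// fiber.
have [h hE] := choice ex.
exists N, (fun x => h (f x) x); split=> [x|x x' fx]; first by have [+ _] := hE (f x); apply.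
by rewrite fx; have [_] := hE (f x'); apply.
Qed.

(** Division by [N] recovers the level and leaves the fiber index as remainder. *)
Lemma injection_of_fiber_index (X Y : Type) (f : X -> Y) (N : nat) (idx : X -> nat) :
  (forall x, (idx x < N)%N) -> (forall x x', f x = f x' -> idx x = idx x' -> x = x') ->
  injective (fun a : X * nat => (f a.1, (a.2 * N + idx a.1)%N)).
Proof.
move=> iN inj [x n] [x' n'] [/= fx e].
have N0 : (0 < N)%N by exact: leq_ltn_trans (iN x).
have nn : n = n'.
  by move/(congr1 (divn^~ N)): e; rewrite !divnMDl// !divn_small// !addn0.
by rewrite nn in e *; rewrite (inj _ _ fx (addnI e)).
Qed.

Lemma controlled_near (X Y : metricType R) (f : X -> Y) (F : X * nat -> Y * nat)
    (C : R) (K : nat) : uniformly_expansive f ->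
  (forall a, mdist (f a.1) (F a).1 <= C) -> (forall a, (F a).2 < a.2.+1 * K)%N ->
  controlled F.
Proof.
(* Uniform expansiveness speaks of positive radii only, hence the maximum with 1. *)
move=> uf fF FK r n; have r0 : 0 < Num.max r 1 by rewrite lt_max ltr01 orbT.
have [s s0 hs] := uf _ r0.
exists (C + (s + C)), (n * K)%N => a b [ab an bn]; split.
- apply: (le_trans (metric_triangle _ (f a.1) _)); apply: lerD.
    by rewrite metric_sym.
  apply: (le_trans (metric_triangle _ (f b.1) _)); apply: lerD => //.
  by apply: hs; rewrite le_max ab.
- by apply: leq_trans (FK a) _; rewrite leq_mul2r an orbT.
- by apply: leq_trans (FK b) _; rewrite leq_mul2r bn orbT.
Qed.

(** In either Cantor-Bernstein case [F a] stays near f: its first coordinate is f(a.1), or a.1 is g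
    of it and f g is close to the identity. The same dichotomy, read at [G b], controls [G]. *)
Lemma stably_equivalent_of_coarse (X Y : metricType R) :
  bounded_geometry X -> bounded_geometry Y ->
  coarsely_equivalent X Y -> stably_equivalent X Y.
Proof.
move=> hX hY [f [g [uf ug [c c0 fg] [d d0 gf]]]].
have fib_f x x' : f x = f x' -> mdist x x' <= d + d.
  move=> fx; apply: (le_trans (metric_triangle _ (g (f x)) _)); apply: lerD.
    by rewrite metric_sym; exact: gf.
  by rewrite fx; exact: gf.
have fib_g y y' : g y = g y' -> mdist y y' <= c + c.
  move=> gy; apply: (le_trans (metric_triangle _ (f (g y)) _)); apply: lerD.
    by rewrite metric_sym; exact: fg.
  by rewrite gy; exact: fg.
have [N [idx [idxN idx_inj]]] := fiber_index hX (addr_ge0 (ltW d0) (ltW d0)) fib_f.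
have [M [jdx [jdxM jdx_inj]]] := fiber_index hY (addr_ge0 (ltW c0) (ltW c0)) fib_g.
have [F [G [FK GK FE]]] := Cantor_Bernstein_pointwise
  (injection_of_fiber_index idxN idx_inj) (injection_of_fiber_index jdxM jdx_inj).
pose K := maxn N M.
(* [bound] limits the level reached by an injection, [lower] the level from which an injection
   reaches a given one; both alternatives thus allow growth by at most the factor [K]. *)
have bound (n k L : nat) : (k < L)%N -> (L <= K)%N -> (n * L + k < n.+1 * K)%N.
  move=> kL LK; apply: (@leq_trans (n.+1 * L)); last by rewrite leq_mul2l LK orbT.
  by rewrite mulSn addnC ltn_add2r.
have lower (n k L : nat) : (k < L)%N -> (L <= K)%N -> (n < (n * L + k).+1 * K)%N.
  move=> kL LK; have L0 : (0 < L)%N by exact: leq_ltn_trans kL.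
  apply: (@leq_trans (n * L + k).+1); last by rewrite leq_pmulr// (leq_trans L0).
  by rewrite ltnS (leq_trans (leq_pmulr n L0))// leq_addr.
exists F, G; split=> //.
- apply: (@controlled_near _ _ f F c K uf) => a; have [->|aE] := FE a.
  + by rewrite mdistxx ltW.
  + by rewrite {1}aE; exact: fg.
  + by apply: bound; rewrite ?leq_maxl.
  + by rewrite {2}aE; apply: lower; rewrite ?leq_maxr.
- have GE b : b = (f (G b).1, ((G b).2 * N + idx (G b).1)%N) \/
      G b = (g b.1, (b.2 * M + jdx b.1)%N).
    by have := FE (G b); rewrite GK.
  apply: (@controlled_near _ _ g G d K ug) => b; have [bE|->] := GE b.
  + by rewrite {1}bE; exact: gf.
  + by rewrite mdistxx ltW.
  + by rewrite {2}bE; apply: lower; rewrite ?leq_maxl.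
  + by apply: bound; rewrite ?leq_maxr.
Qed.

Lemma expansive_of_controlled (X Y : metricType R) (F : X * nat -> Y * nat) :
  controlled F -> uniformly_expansive (fun x => (F (x, 0%N)).1).
Proof.
move=> cF r r0; have [r' [n' h]] := cF r 1%N.
exists (Num.max r' 1); first by rewrite lt_max ltr01 orbT.
by move=> x x' xx; have [|h1 _ _] := h (x, 0%N) (x', 0%N); rewrite ?le_max ?h1.
Qed.

Lemma close_of_controlled (X Y : metricType R) (F : X * nat -> Y * nat)
    (G : Y * nat -> X * nat) : cancel F G -> controlled F -> controlled G ->
  close_maps ((fun y => (G (y, 0%N)).1) \o (fun x => (F (x, 0%N)).1)) (@id X).
Proof.
(* The point [F (x, 0)] has level below [n0] and is compared with the point at level 0 having the
   same first coordinate. The bound [n0.+1] admits both levels, and [G] sends [F (x, 0)] back to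
   [(x, 0)]. *)
move=> FK cF cG; have [r0 [n0 h0]] := cF 0 1%N; have [r1 [n1 h1]] := cG 0 n0.+1.
exists (Num.max r1 1); first by rewrite lt_max ltr01 orbT.
move=> x /=; have [|_ F2 _] := h0 (x, 0%N) (x, 0%N); first by split=> //=; rewrite mdistxx.
have [|+ _ _] := h1 ((F (x, 0%N)).1, 0%N) (F (x, 0%N)).
  by split=> //=; [rewrite mdistxx|exact: ltnW].
by rewrite FK/= le_max => ->.
Qed.

Lemma coarse_of_stably_equivalent (X Y : metricType R) :
  stably_equivalent X Y -> coarsely_equivalent X Y.
Proof.
move=> [F [G [FK GK cF cG]]].
exists (fun x => (F (x, 0%N)).1), (fun y => (G (y, 0%N)).1); split.
- exact: expansive_of_controlled.
- exact: expansive_of_controlled.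
- exact: close_of_controlled.
- exact: close_of_controlled.
Qed.

End coarse_equivalence.

Theorem theorem3p4 (R : realType) (X Y : metricType R)
    (hX : bounded_geometry X) (hY : bounded_geometry Y) :
  [<->
    coarsely_equivalent X Y ;
    forall (p : R) (p1 : 1 <= p), exists phi,
      isometric_iso (stable_Roe p1 X) (stable_Roe p1 Y) phi /\
      phi @` stable_Cartan p1 X = stable_Cartan p1 Y ;
    forall (p : R) (p1 : 1 <= p), exists phi,
      isometric_iso (stable_Roe p1 X) (stable_Roe p1 Y) phi ;
    exists (p : R) (p1 : 1 <= p), p != 2 /\
      exists phi, isometric_iso (stable_Roe p1 X) (stable_Roe p1 Y) phi ;
    exists (p : R) (p1 : 1 <= p) phi,
      isometric_iso (stable_Roe p1 X) (stable_Roe p1 Y) phi /\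
      phi @` stable_Cartan p1 X = stable_Cartan p1 Y ].
Proof.
tfae.
- move=> XY p p1; apply: iso_of_stably_equivalent.
  exact: stably_equivalent_of_coarse.
- by move=> h p p1; have [phi [phi_iso _]] := h p p1; exists phi.
(* The exponent 1 is a convenient choice different from 2. *)
- move=> h; exists 1, (lexx 1); split; last exact: h.
  by rewrite lt_eqF// ltr1n.
(* The isomorphism is not kept: it yields a bijection, and conjugation by this bijection respects
   the Cartan subalgebras for the same exponent. *)
- move=> [p [p1 [p2 [phi phi_iso]]]]; exists p, p1.
  exact/iso_of_stably_equivalent/(stably_equivalent_of_iso hX hY p2 phi_iso).
- move=> [p [p1 [phi [phi_iso phiC]]]]; apply: coarse_of_stably_equivalent.
  exact: (stably_equivalent_of_Cartan_iso hX hY phi_iso phiC).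
Qed.
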